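(* Suppose $(c_n)_{n\ge0}$ is a complex sequence and $f(z)=\sum_{n=0}^{\infty}c_nz^n$ is defined on an open domain $D$ (an open disk centered at $0$). Then the following statements are equivalent: (a) The function $f_{\sigma'}$ exists on $D$, i.e. the limit defining $f_{\sigma'}(z)$ exists for every $z\in D$. (b) The Bernoulli polynomial series $\sum_{n=1}^{\infty}c_nB_n(z+1)$ is convergent on $D$. (c) The series $\sum_{n=1}^{\infty}nc_nS_{n-1}(z)$ is convergent on $D$. (d) The function $f'$ is analytically summable on $D$. If one of these equivalent conditions holds, then $$\sum_{n=0}^{\infty}c_nB_n(z+1)=f_{\sigma'}(z)=f'_{\sigma}(z)+f_{\sigma'}(0)=\sum_{n=1}^{\infty}nc_nS_{n-1}(z)+f_{\sigma'}(0),\qquad z\in D,$$ and thus (putting $z=0$) the constant $\lambda(f):=\sum_{n=0}^\infty c_n\mathfrak{b}_n$ equals $f_{\sigma'}(0)$.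
   Context: $B_n(z)$ denotes the $n$-th Bernoulli polynomial, defined by $\frac{te^{zt}}{e^t-1}=\sum_{n=0}^\infty B_n(z)\frac{t^n}{n!}$ for $|t|<2\pi$, and $\mathfrak{b}_n:=B_n(1)$. For $n\ge 0$ and $z\in\mathbb{C}$ put $S_n(z):=\frac{B_{n+1}(z+1)-\mathfrak{b}_{n+1}}{n+1}$. A function $g(z)=\sum_{n=0}^\infty a_nz^n$, given by a power series on an open disk $D$ centered at $0$, is analytically summable at $z$ if the series $g_\sigma(z):=\sum_{n=0}^\infty a_nS_n(z)$ converges, and analytically summable on $D$ if this holds at every $z\in D$. For $f(z)=\sum_{n=0}^\infty c_nz^n$ put $$f_{\sigma'}(z):=\lim_{N\to\infty}\sum_{n=0}^{N}c_nS_n'(z),\qquad f'_\sigma(z):=(f')_\sigma(z)=\sum_{n=0}^\infty (n+1)c_{n+1}S_n(z).$$ *)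

(* Defs.v *)
From Stdlib Require Import Reals Factorial.
From Coquelicot Require Import Coquelicot.

Open Scope C_scope.

(* [C] carries several normed-module structures in Coquelicot; the scalar field
   is fixed to [C_AbsRing] so that inference does not pick a real one. *)
Definition is_Cseries (u : nat -> C) (l : C) : Prop :=
  @is_series C_AbsRing C_NormedModule u l.

Definition is_Cseries_from (m : nat) (u : nat -> C) (l : C) : Prop :=
  is_Cseries (fun k : nat => u (m + k)%nat) l.

Definition ex_Cseries_from (m : nat) (u : nat -> C) : Prop :=
  exists l : C, is_Cseries_from m u l.

Definition Cexp (z : C) : C := RtoC (exp (Re z)) * (cos (Im z), sin (Im z)).

(* The open disk of radius [r] centered at 0; [r = p_infty] gives the plane. *)
Definition in_disk (r : Rbar) (z : C) : Prop := Rbar_lt (Cmod z) r.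

Definition power_series_on (r : Rbar) (a : nat -> C) (g : C -> C) : Prop :=
  forall z : C, in_disk r z -> is_Cseries (fun n => a n * z ^ n) (g z).

(* The generating function determines each value [B n z] uniquely. Its
   singularity at t = 0 is removable, so t = 0 is left out. *)
Definition is_bernoulli (B : nat -> C -> C) : Prop :=
  forall z t : C, t <> 0 -> (Cmod t < 2 * PI)%R ->
    is_Cseries (fun n => B n z * (t ^ n / RtoC (INR (fact n))))
               (t * Cexp (z * t) / (Cexp t - 1)).

Definition bernoulli_number (B : nat -> C -> C) (n : nat) : C := B n 1.

Definition Ssum (B : nat -> C -> C) (n : nat) (z : C) : C :=
  (B (n + 1)%nat (z + 1) - bernoulli_number B (n + 1)) / RtoC (INR (n + 1)).

(* [is_sigma B r g z l] : g_sigma(z) = l, where the a_n are the coefficients of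
   the power series of [g] on the disk (unique when [0 < r]). *)
Definition is_sigma (B : nat -> C -> C) (r : Rbar) (g : C -> C) (z l : C)
  : Prop :=
  exists a : nat -> C,
    power_series_on r a g /\ is_Cseries (fun n => a n * Ssum B n z) l.

Definition analytically_summable_at (B : nat -> C -> C) (r : Rbar) (g : C -> C)
  (z : C) : Prop := exists l : C, is_sigma B r g z l.

Definition analytically_summable_on_disk (B : nat -> C -> C) (r : Rbar)
  (g : C -> C) : Prop :=
  forall z : C, in_disk r z -> analytically_summable_at B r g z.

(* Full complex differentiability: Coquelicot's total [C_derive] only takes the
   limit along the real direction. *)
Definition is_Cderive (f : C -> C) (z l : C) : Prop :=
  @is_derive C_AbsRing C_NormedModule f z l.

Definition is_Cderive_on_disk (r : Rbar) (f f' : C -> C) : Prop :=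
  forall z : C, in_disk r z -> is_Cderive f z (f' z).

(* f_{sigma'}(z) = l, for f with coefficients [c]; [dS n] is S_n'(z). *)
Definition is_sigma' (B : nat -> C -> C) (c : nat -> C) (z l : C) : Prop :=
  exists dS : nat -> C,
    (forall n : nat, is_Cderive (Ssum B n) z (dS n)) /\
    is_Cseries (fun n => c n * dS n) l.

(* Main.v *)
(** The only deep implication is (c) => (b): since n S_{n-1}(z) = B_n(z+1) - b_n,
one has to recover the convergence of the series of the c_n b_n from that of the
c_n (B_n(z+1) - b_n). For a small real x in the disk, combine the points x and -x
into the convergent series of c_n (2 b_n - B_n(x) - B_n(1-x)), whose terms vanish for odd
n >= 3. On the circle R/Z, integration by parts turns, up to a common sign and a
factor (2m)!, b_{2m} into the squared L2 norm a_m of B_m/m!, and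
2 b_{2m} - B_{2m}(x) - B_{2m}(1-x) into the squared norm A_m of the difference of B_m/m!
and its translate by x. Cauchy-Schwarz makes both sequences log-convex; as the
generating function converges for |t| < 2 pi, (2 pi)^{2m} a_m and (2 pi)^{2m} A_m grow
subexponentially, hence are nonincreasing, and testing against the first harmonic
bounds (2 pi)^{2m} A_m from below. So the quotient b_{2m} / (2 b_{2m} - B_{2m}(x) -
B_{2m}(1-x)) is a product of two bounded monotone sequences, and Abel's test applies. *)

Require Import Defs.
From Stdlib Require Import Reals Lra Lia Factorial.
From Coquelicot Require Import Coquelicot.

Open Scope C_scope.

(** * Complex series *)

(** Knowing the limit of the ratio of b_n to a difference of Bernoulli values would not be enough:
    the series involved may converge only conditionally, so the ratio must have bounded variation,
    and a product of bounded monotone sequences provides this. At a single point x, B_n(x+1) - b_n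
    mixes all orders, and for odd n >= 3 the number b_n is 0 while the difference need not be;
    symmetrising in x and -x removes these orders. The price is the term n x^{n-1} in B_n(x+1) =
    B_n(x) + n x^{n-1}, paid by the convergent series of f'(x). The constant 2 pi has two origins:
    it is the distance from 0 to the nearest pole of the generating function, hence governs the
    growth of the coefficients, and it is the frequency of the first harmonic on a circle of length
    1. Because these two rates agree, the scaled energies of the translates are monotone and yet
    bounded away from 0. As B is given only by its generating function, its identities come from
    comparing coefficients at small real t. *)

(** Balls of [C_UniformSpace] are products of real balls, so the limit can be taken in each
    component. This gives access to the real theory of series. *)
Lemma is_Cseries_Re_Im (u : nat -> C) (l : C) :
  is_Cseries u l <->
  is_series (fun n => Re (u n)) (Re l) /\ is_series (fun n => Im (u n)) (Im l).
Proof.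
assert (HR : forall n, Re (sum_n u n) = sum_n (fun k => Re (u k)) n).
{ induction n as [|n IH]; [now rewrite !sum_O|].
  rewrite !sum_Sn, <- IH. reflexivity. }
assert (HI : forall n, Im (sum_n u n) = sum_n (fun k => Im (u k)) n).
{ induction n as [|n IH]; [now rewrite !sum_O|].
  rewrite !sum_Sn, <- IH. reflexivity. }
split.
- intros H.
  assert (H' := proj1 (@filterlim_locally _ C_UniformSpace eventually _ _ _) H).
  split; apply (proj2 (@filterlim_locally _ R_UniformSpace eventually _ _ _));
    intros eps; destruct (H' eps) as [N HN]; exists N; intros n Hn;
    destruct (HN n Hn) as [H1 H2].
  + rewrite <- HR. exact H1.
  + rewrite <- HI. exact H2.
- intros [H1 H2]. apply (proj2 (@filterlim_locally _ C_UniformSpace eventually _ _ _)).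
  intros eps.
  destruct (proj1 (@filterlim_locally _ R_UniformSpace eventually _ _ _) H1 eps) as [N1 HN1].
  destruct (proj1 (@filterlim_locally _ R_UniformSpace eventually _ _ _) H2 eps) as [N2 HN2].
  exists (max N1 N2). intros n Hn.
  specialize (HN1 n ltac:(lia)). specialize (HN2 n ltac:(lia)).
  rewrite <- HR in HN1. rewrite <- HI in HN2. split; assumption.
Qed.

(** A total sum, so that functions of z can be defined without choosing limits; it is meaningful
    only through [is_Cseries_unique] and [CSeries_correct]. *)
Definition CSeries (u : nat -> C) : C :=
  (Series (fun n => Re (u n)), Series (fun n => Im (u n))).

Lemma is_Cseries_unique (u : nat -> C) (l : C) : is_Cseries u l -> CSeries u = l.
Proof.
rewrite is_Cseries_Re_Im. intros [H1 H2]. unfold CSeries.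
rewrite (is_series_unique _ _ H1), (is_series_unique _ _ H2). now destruct l.
Qed.

Lemma CSeries_correct (u : nat -> C) (l : C) :
  is_Cseries u l -> is_Cseries u (CSeries u).
Proof. intros H. now rewrite (is_Cseries_unique _ _ H). Qed.

Lemma is_Cseries_ext (u v : nat -> C) (l : C) :
  (forall n, u n = v n) -> is_Cseries u l -> is_Cseries v l.
Proof. intros H. now apply is_series_ext. Qed.

Lemma is_Cseries_plus (u v : nat -> C) (l m : C) :
  is_Cseries u l -> is_Cseries v m -> is_Cseries (fun n => u n + v n) (l + m).
Proof. intros Hu Hv. exact (is_series_plus _ _ _ _ Hu Hv). Qed.

Lemma is_Cseries_scal (a : C) (u : nat -> C) (l : C) :
  is_Cseries u l -> is_Cseries (fun n => a * u n) (a * l).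
Proof. intros Hu. exact (is_series_scal a _ _ Hu). Qed.

Lemma is_Cseries_minus (u v : nat -> C) (l m : C) :
  is_Cseries u l -> is_Cseries v m -> is_Cseries (fun n => u n - v n) (l - m).
Proof. intros Hu Hv. exact (is_series_minus _ _ _ _ Hu Hv). Qed.

Lemma is_Cseries_shift (u : nat -> C) (l : C) :
  is_Cseries (fun n => u (S n)) l <-> is_Cseries u (l + u 0%nat).
Proof.
split; intros H.
- apply is_series_decr_1.
  change (is_Cseries (fun k => u (S k)) (l + u 0%nat + - u 0%nat)).
  replace (l + u 0%nat + - u 0%nat) with l by ring. exact H.
- exact (is_series_incr_1 _ _ H).
Qed.

Lemma Cmult_RtoC_pow_Re_Im (a : C) (t : R) (n : nat) :
  Re (a * RtoC t ^ n) = (Re a * t ^ n)%R /\ Im (a * RtoC t ^ n) = (Im a * t ^ n)%R.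
Proof.
rewrite <- RtoC_pow. destruct a as [x y]; unfold Re, Im, Cmult, RtoC; simpl.
split; ring.
Qed.

(** Powers of a real t are real, so the series splits into two real power series. This is why
    generating functions are compared at real t only. *)
Lemma is_Cseries_real_var (a : nat -> C) (t : R) (l : C) :
  is_Cseries (fun n => a n * RtoC t ^ n) l <->
  is_pseries (fun n => Re (a n)) t (Re l) /\ is_pseries (fun n => Im (a n)) t (Im l).
Proof.
rewrite is_Cseries_Re_Im, !is_pseries_R.
assert (HR := fun n => proj1 (Cmult_RtoC_pow_Re_Im (a n) t n)).
assert (HI := fun n => proj2 (Cmult_RtoC_pow_Re_Im (a n) t n)).
split; intros [H1 H2]; split.
- exact (is_series_ext _ _ _ HR H1).
- exact (is_series_ext _ _ _ HI H2).
- exact (is_series_ext _ _ _ (fun n => eq_sym (HR n)) H1).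
- exact (is_series_ext _ _ _ (fun n => eq_sym (HI n)) H2).
Qed.

(** Beyond the radius the terms do not tend to 0, so convergence at a single point bounds the radius
    from below. *)
Lemma CV_radius_ge (a : nat -> R) (x : R) :
  ex_pseries a x -> Rbar_le (Rabs x) (CV_radius a).
Proof.
intros H. apply Rbar_not_lt_le. intros Hlt. apply (CV_disk_outside _ _ Hlt).
apply ex_series_lim_0. destruct H as [l Hl]. exists l. now apply is_pseries_R in Hl.
Qed.

(* Multiplying by the variable removes the point [t = 0] from consideration. *)
Lemma PSeries_coef_unique (a b : nat -> R) (rho : R) :
  (0 < rho)%R ->
  (forall t : R, t <> 0%R -> (Rabs t < rho)%R ->
     exists l : R, is_pseries a t l /\ is_pseries b t l) ->
  forall n, a n = b n.
Proof.
intros Hrho H n.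
assert (Hr : Rabs (rho / 2) = (rho / 2)%R) by (apply Rabs_pos_eq; lra).
destruct (H (rho / 2)%R ltac:(lra) ltac:(rewrite Hr; lra)) as [l0 [Ha Hb]].
assert (Hca := CV_radius_ge a (rho/2) (ex_intro _ _ Ha)).
assert (Hcb := CV_radius_ge b (rho/2) (ex_intro _ _ Hb)).
rewrite Hr in Hca, Hcb.
assert (Ha0 : Rbar_lt 0%R (CV_radius a)).
{ apply Rbar_lt_le_trans with (2 := Hca). simpl; lra. }
assert (Hb0 : Rbar_lt 0%R (CV_radius b)).
{ apply Rbar_lt_le_trans with (2 := Hcb). simpl; lra. }
change (PS_incr_1 a (S n) = PS_incr_1 b (S n)).
apply PSeries_ext_recip; rewrite ?CV_radius_incr_1; auto.
exists (mkposreal rho Hrho). intros t Ht. rewrite !PSeries_incr_1.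
destruct (Req_dec t 0) as [->|Ht0]; [now rewrite !Rmult_0_l|].
destruct (H t Ht0) as [l [Hl1 Hl2]].
{ change (Rabs (t - 0) < rho)%R in Ht. now rewrite Rminus_0_r in Ht. }
now rewrite (is_pseries_unique _ _ _ Hl1), (is_pseries_unique _ _ _ Hl2).
Qed.

(** The tool for identities between Bernoulli polynomials: a relation between generating functions
    on a punctured real interval passes to the coefficients. *)
Lemma Cpower_series_coef_unique (a b : nat -> C) (rho : R) :
  (0 < rho)%R ->
  (forall t : R, t <> 0%R -> (Rabs t < rho)%R -> exists l : C,
     is_Cseries (fun n => a n * RtoC t ^ n) l /\
     is_Cseries (fun n => b n * RtoC t ^ n) l) ->
  forall n, a n = b n.
Proof.
intros Hrho H n.
assert (HR : Re (a n) = Re (b n)).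
{ refine (PSeries_coef_unique (fun n => Re (a n)) (fun n => Re (b n)) rho Hrho _ n).
  intros t H0 H1. destruct (H t H0 H1) as [l [Ha Hb]]. exists (Re l).
  apply is_Cseries_real_var in Ha, Hb. tauto. }
assert (HI : Im (a n) = Im (b n)).
{ refine (PSeries_coef_unique (fun n => Im (a n)) (fun n => Im (b n)) rho Hrho _ n).
  intros t H0 H1. destruct (H t H0 H1) as [l [Ha Hb]]. exists (Im l).
  apply is_Cseries_real_var in Ha, Hb. tauto. }
destruct (a n), (b n); simpl in *; congruence.
Qed.

Lemma sum_n_Cmult_Re_Im (a b : nat -> C) (n : nat) :
  let s := sum_n (fun k => a k * b (n - k)%nat) n in
  Re s = (PS_mult (fun k => Re (a k)) (fun k => Re (b k)) n
          - PS_mult (fun k => Im (a k)) (fun k => Im (b k)) n)%R /\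
  Im s = (PS_mult (fun k => Re (a k)) (fun k => Im (b k)) n
          + PS_mult (fun k => Im (a k)) (fun k => Re (b k)) n)%R.
Proof.
intros s. unfold s, PS_mult. clear s.
(* The upper limit is decoupled from the [n] inside [n - k], so that induction applies. *)
enough (H : forall m,
  Re (sum_n (fun k => a k * b (n - k)%nat) m) =
  (sum_f_R0 (fun k => Re (a k) * Re (b (n - k)%nat)) m
   - sum_f_R0 (fun k => Im (a k) * Im (b (n - k)%nat)) m)%R /\
  Im (sum_n (fun k => a k * b (n - k)%nat) m) =
  (sum_f_R0 (fun k => Re (a k) * Im (b (n - k)%nat)) m
   + sum_f_R0 (fun k => Im (a k) * Re (b (n - k)%nat)) m)%R) by apply H.
induction m as [|m [IH1 IH2]].
- rewrite sum_O. split; reflexivity.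
- rewrite sum_Sn. simpl sum_f_R0. split.
  + change (Re (sum_n (fun k => a k * b (n - k)%nat) m + a (S m) * b (n - S m)%nat)
      = (sum_f_R0 (fun k => Re (a k) * Re (b (n - k)%nat)) m + Re (a (S m)) * Re (b (n - S m)%nat)
   - (sum_f_R0 (fun k => Im (a k) * Im (b (n - k)%nat)) m + Im (a (S m)) * Im (b (n - S m)%nat)))%R).
    rewrite re_plus, IH1. unfold Re, Im. simpl. ring.
  + change (Im (sum_n (fun k => a k * b (n - k)%nat) m + a (S m) * b (n - S m)%nat)
      = (sum_f_R0 (fun k => Re (a k) * Im (b (n - k)%nat)) m + Re (a (S m)) * Im (b (n - S m)%nat)
   + (sum_f_R0 (fun k => Im (a k) * Re (b (n - k)%nat)) m + Im (a (S m)) * Re (b (n - S m)%nat)))%R).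
    rewrite im_plus, IH2. unfold Re, Im. simpl. ring.
Qed.

(** Convergence at the larger point [rho] puts [t] strictly inside the radius of each real
    component, where convergence is absolute and products are allowed. *)
Lemma is_Cseries_Cauchy_product (a b : nat -> C) (rho t : R) (la lb : C) :
  (Rabs t < rho)%R ->
  (exists l, is_Cseries (fun n => a n * RtoC rho ^ n) l) ->
  (exists l, is_Cseries (fun n => b n * RtoC rho ^ n) l) ->
  is_Cseries (fun n => a n * RtoC t ^ n) la ->
  is_Cseries (fun n => b n * RtoC t ^ n) lb ->
  is_Cseries (fun n => sum_n (fun k => a k * b (n - k)%nat) n * RtoC t ^ n) (la * lb).
Proof.
intros Ht [ma Ma] [mb Mb] Ha Hb.
apply is_Cseries_real_var in Ma, Mb, Ha, Hb.
assert (Hcv : forall (u : nat -> R) l, is_pseries u rho l -> Rbar_lt (Rabs t) (CV_radius u)).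
{ intros u l Hu. apply Rbar_lt_le_trans with (Rabs rho).
  - simpl. pose proof (Rle_abs rho). lra.
  - apply CV_radius_ge. now exists l. }
destruct Ma as [Ma1 Ma2], Mb as [Mb1 Mb2], Ha as [Ha1 Ha2], Hb as [Hb1 Hb2].
apply Hcv in Ma1, Ma2, Mb1, Mb2.
apply is_Cseries_real_var. split.
- eapply is_pseries_ext; [intros n; symmetry; apply sum_n_Cmult_Re_Im|].
  replace (Re (la * lb)) with (Re la * Re lb - Im la * Im lb)%R by (unfold Re, Im; simpl; ring).
  apply (is_pseries_minus (PS_mult _ _) (PS_mult _ _) t (Re la * Re lb)%R (Im la * Im lb)%R);
   now apply is_pseries_mult.
- eapply is_pseries_ext; [intros n; symmetry; apply sum_n_Cmult_Re_Im|].
  replace (Im (la * lb)) with (Re la * Im lb + Im la * Re lb)%R by (unfold Re, Im; simpl; ring).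
  apply (is_pseries_plus (PS_mult _ _) (PS_mult _ _) t (Re la * Im lb)%R (Im la * Re lb)%R);
   now apply is_pseries_mult.
Qed.

(** * The exponential series and Bernoulli polynomials *)

Lemma Im_le_Cmod (z : C) : (Rabs (Im z) <= Cmod z)%R.
Proof. apply Rle_trans with (2 := Rmax_Cmod z). apply Rmax_r. Qed.

Definition ecoef (z : C) (n : nat) : C := z ^ n / RtoC (INR (fact n)).

Lemma RtoC_INR_fact_neq_0 (n : nat) : RtoC (INR (fact n)) <> 0.
Proof. intros H. apply RtoC_inj in H. exact (INR_fact_neq_0 n H). Qed.

Lemma RtoC_INR_S_neq_0 (n : nat) : RtoC (INR (S n)) <> 0.
Proof. intros H. apply RtoC_inj in H. exact (not_0_INR (S n) ltac:(lia) H). Qed.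

Lemma RtoC_INR_fact_S (n : nat) :
  RtoC (INR (fact (S n))) = RtoC (INR (S n)) * RtoC (INR (fact n)).
Proof. rewrite <- RtoC_mult, <- mult_INR. reflexivity. Qed.

Lemma ecoef_S (z : C) (n : nat) : RtoC (INR (S n)) * ecoef z (S n) = z * ecoef z n.
Proof.
unfold ecoef. rewrite RtoC_INR_fact_S, Cpow_S. field.
split; [apply RtoC_INR_fact_neq_0 | apply RtoC_INR_S_neq_0].
Qed.

Lemma Cmod_ecoef (z : C) (n : nat) : Cmod (ecoef z n) = (Cmod z ^ n / INR (fact n))%R.
Proof.
unfold ecoef. rewrite Cmod_div by apply RtoC_INR_fact_neq_0.
rewrite Cmod_pow, Cmod_R, Rabs_pos_eq; [reflexivity|apply pos_INR].
Qed.

Lemma ex_pseries_exp_dominated (a : nat -> R) (M t : R) :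
  (forall n, Rabs (a n) <= M ^ n / INR (fact n))%R -> ex_pseries a t.
Proof.
intros Ha.
enough (ex_series (fun n => a n * t ^ n)%R) as [l Hl] by (exists l; now apply is_pseries_R).
apply (ex_series_le (V := R_CompleteNormedModule) _ (fun n => / INR (fact n) * (M * Rabs t) ^ n)%R).
- intros n. change (Rabs (a n * t ^ n) <= / INR (fact n) * (M * Rabs t) ^ n)%R.
  rewrite Rabs_mult, <- RPow_abs, Rpow_mult_distr.
  replace (/ INR (fact n) * (M ^ n * Rabs t ^ n))%R
    with (M ^ n / INR (fact n) * Rabs t ^ n)%R by (unfold Rdiv; ring).
  apply Rmult_le_compat_r; [apply pow_le, Rabs_pos | apply Ha].
- exists (exp (M * Rabs t)). apply is_pseries_R, is_exp_Reals.
Qed.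

Lemma CV_radius_entire (a : nat -> R) :
  (forall t, ex_pseries a t) -> CV_radius a = p_infty.
Proof.
intros Ha.
assert (H : forall x : R, (0 < x)%R -> Rbar_le x (CV_radius a)).
{ intros x Hx. rewrite <- (Rabs_pos_eq x) by lra. now apply CV_radius_ge. }
destruct (CV_radius a) as [x| |]; [|reflexivity|].
- specialize (H (Rabs x + 1)%R). simpl in H.
  pose proof (Rle_abs x). pose proof (Rabs_pos x). specialize (H ltac:(lra)). lra.
- destruct (H 1%R ltac:(lra)).
Qed.

Lemma derive_zero_constant (f : R -> R) (t : R) :
  (forall s, is_derive f s 0%R) -> f t = f 0%R.
Proof.
intros H. destruct (Rtotal_order t 0) as [Ht|[->|Ht]].
- apply (eq_is_derive f t 0%R); [intros; apply H | lra].
- reflexivity.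
- symmetry. apply (eq_is_derive f 0%R t); [intros; apply H | lra].
Qed.

(* exp (-(x + iy) t) (P + iQ) has derivative 0. *)
Lemma linear_ode_unique (x y : R) (P Q : R -> R) :
  (forall s, is_derive P s (x * P s - y * Q s)%R) ->
  (forall s, is_derive Q s (x * Q s + y * P s)%R) ->
  P 0%R = 1%R -> Q 0%R = 0%R -> forall t : R,
  P t = (exp (x * t) * cos (y * t))%R /\ Q t = (exp (x * t) * sin (y * t))%R.
Proof.
intros DP DQ P0 Q0 t.
assert (D1 : forall s, is_derive
  (fun s => exp (- x * s) * (P s * cos (y * s) + Q s * sin (y * s)))%R s 0%R).
{ intros s. auto_derive.
  - repeat split; eexists; [apply DP|apply DQ].
  - replace (Derive (fun x0 : R => P x0) s) with (x * P s - y * Q s)%R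
      by (symmetry; apply is_derive_unique, DP).
    replace (Derive (fun x0 : R => Q x0) s) with (x * Q s + y * P s)%R
      by (symmetry; apply is_derive_unique, DQ). ring. }
assert (D2 : forall s, is_derive
  (fun s => exp (- x * s) * (Q s * cos (y * s) - P s * sin (y * s)))%R s 0%R).
{ intros s. auto_derive.
  - repeat split; eexists; [apply DQ|apply DP].
  - replace (Derive (fun x0 : R => P x0) s) with (x * P s - y * Q s)%R
      by (symmetry; apply is_derive_unique, DP).
    replace (Derive (fun x0 : R => Q x0) s) with (x * Q s + y * P s)%R
      by (symmetry; apply is_derive_unique, DQ). ring. }
assert (E1 := derive_zero_constant _ t D1).
assert (E2 := derive_zero_constant _ t D2).
cbv beta in E1, E2.
rewrite P0, Q0, !Rmult_0_r, exp_0, cos_0, sin_0 in E1, E2.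
assert (Hexp : (exp (x * t) * exp (- x * t) = 1)%R).
{ rewrite <- exp_plus, <- exp_0. f_equal. ring. }
assert (Hsc : (sin (y * t) * sin (y * t) + cos (y * t) * cos (y * t) = 1)%R)
  by exact (sin2_cos2 (y * t)).
revert E1 E2 Hexp Hsc.
generalize (exp (x * t)), (exp (- x * t)), (cos (y * t)), (sin (y * t)), (P t), (Q t).
intros e f c s p q E1 E2 Hexp Hsc. split.
(* [E1] and [E2] say that exp(-(x + iy)t) (P + iQ) has components 1 and 0. Multiplying by [e] and
   rotating back by the angle yt recovers p and q. *)
- transitivity (e * ((f * (p * c + q * s)) * c - (f * (q * c - p * s)) * s))%R.
  + transitivity ((e * f) * p * (s * s + c * c))%R; [rewrite Hexp, Hsc|]; ring.
  + rewrite E1, E2. ring.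
- transitivity (e * ((f * (p * c + q * s)) * s + (f * (q * c - p * s)) * c))%R.
  + transitivity ((e * f) * q * (s * s + c * c))%R; [rewrite Hexp, Hsc|]; ring.
  + rewrite E1, E2. ring.
Qed.

(** The recursion [ecoef_S] says that the sum P + iQ has t-derivative z(P + iQ); uniqueness for this
    linear system identifies it with [Cexp]. *)
Lemma is_Cseries_exp (z : C) (t : R) :
  is_Cseries (fun n => ecoef z n * RtoC t ^ n) (Cexp (z * RtoC t)).
Proof.
set (a := fun n => Re (ecoef z n)). set (b := fun n => Im (ecoef z n)).
set (x := Re z). set (y := Im z).
assert (Ha : forall s, ex_pseries a s).
{ intros s. apply ex_pseries_exp_dominated with (Cmod z). intros n.
  rewrite <- Cmod_ecoef. apply re_le_Cmod. }
assert (Hb : forall s, ex_pseries b s).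
{ intros s. apply ex_pseries_exp_dominated with (Cmod z). intros n.
  rewrite <- Cmod_ecoef. apply Im_le_Cmod. }
assert (Ra := CV_radius_entire a Ha). assert (Rb := CV_radius_entire b Hb).
assert (Da : forall n, PS_derive a n = (x * a n - y * b n)%R).
{ intros n. assert (E := f_equal Re (ecoef_S z n)). unfold PS_derive, a, b, x, y.
  revert E. generalize (ecoef z (S n)), (ecoef z n), (INR (S n)). clear.
  intros p q r E. unfold Re, Im, Cmult, RtoC in *. cbn [fst snd] in *.
  rewrite <- E. ring. }
assert (Db : forall n, PS_derive b n = (x * b n + y * a n)%R).
{ intros n. assert (E := f_equal Im (ecoef_S z n)). unfold PS_derive, a, b, x, y.
  revert E. generalize (ecoef z (S n)), (ecoef z n), (INR (S n)). clear.
  intros p q r E. unfold Re, Im, Cmult, RtoC in *. cbn [fst snd] in *.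
  rewrite <- E. ring. }
assert (DP : forall s, is_derive (PSeries a) s (x * PSeries a s - y * PSeries b s)%R).
{ intros s. assert (D := is_derive_PSeries a s ltac:(now rewrite Ra)).
  replace (x * PSeries a s - y * PSeries b s)%R with (PSeries (PS_derive a) s); [exact D|].
  rewrite <- !PSeries_scal, <- PSeries_minus.
  - apply PSeries_ext. intros n. rewrite Da. reflexivity.
  - apply ex_pseries_scal; [intros; apply Rmult_comm | apply Ha].
  - apply ex_pseries_scal; [intros; apply Rmult_comm | apply Hb]. }
assert (DQ : forall s, is_derive (PSeries b) s (x * PSeries b s + y * PSeries a s)%R).
{ intros s. assert (D := is_derive_PSeries b s ltac:(now rewrite Rb)).
  replace (x * PSeries b s + y * PSeries a s)%R with (PSeries (PS_derive b) s); [exact D|].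
  rewrite <- !PSeries_scal, <- PSeries_plus.
  - apply PSeries_ext. intros n. rewrite Db. reflexivity.
  - apply ex_pseries_scal; [intros; apply Rmult_comm | apply Hb].
  - apply ex_pseries_scal; [intros; apply Rmult_comm | apply Ha]. }
assert (P0 : PSeries a 0 = 1%R).
{ rewrite PSeries_0. unfold a, ecoef, Re. simpl. field. }
assert (Q0 : PSeries b 0 = 0%R).
{ rewrite PSeries_0. unfold b, ecoef, Im. simpl. field. }
destruct (linear_ode_unique x y _ _ DP DQ P0 Q0 t) as [HP HQ].
assert (EZ : Cexp (z * RtoC t) = (PSeries a t, PSeries b t)).
{ rewrite HP, HQ. unfold Cexp, x, y, Re, Im, Cmult, RtoC. simpl.
  replace (fst z * t - snd z * 0)%R with (fst z * t)%R by ring.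
  replace (fst z * 0 + snd z * t)%R with (snd z * t)%R by ring.
  f_equal; ring. }
rewrite EZ. apply is_Cseries_real_var. split; apply PSeries_correct; [apply Ha|apply Hb].
Qed.

Lemma Cexp_plus (z w : C) : Cexp (z + w) = Cexp z * Cexp w.
Proof.
unfold Cexp, Re, Im, Cmult, Cplus, RtoC. simpl.
rewrite exp_plus, cos_plus, sin_plus. f_equal; ring.
Qed.

Lemma Cexp_RtoC (t : R) : Cexp (RtoC t) = RtoC (exp t).
Proof.
unfold Cexp, Re, Im, Cmult, RtoC. simpl. rewrite cos_0, sin_0. f_equal; ring.
Qed.

Lemma Cexp_RtoC_neq_1 (t : R) : t <> 0%R -> Cexp (RtoC t) - 1 <> 0.
Proof.
intros Ht H. rewrite Cexp_RtoC in H.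
assert (H1 : (exp t - 1 = 0)%R).
{ apply RtoC_inj. now rewrite RtoC_minus. }
apply Ht, exp_inv. rewrite exp_0. lra.
Qed.

(** Dividing by n! makes the generating function an ordinary power series in t and lets
    differentiation in z lower the index without a factor. *)
Definition bcoef (B : nat -> C -> C) (z : C) (n : nat) : C := B n z / RtoC (INR (fact n)).

Lemma bernoulli_bcoef (B : nat -> C -> C) (n : nat) (z : C) :
  B n z = RtoC (INR (fact n)) * bcoef B z n.
Proof. unfold bcoef. field. apply RtoC_INR_fact_neq_0. Qed.

Lemma bernoulli_series_real (B : nat -> C -> C) (hB : is_bernoulli B) (z : C) (t : R) :
  t <> 0%R -> (Rabs t < 2 * PI)%R ->
  is_Cseries (fun n => bcoef B z n * RtoC t ^ n)
    (RtoC t * Cexp (z * RtoC t) / (Cexp (RtoC t) - 1)).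
Proof.
intros Ht0 Ht. eapply is_Cseries_ext; [|apply (hB z (RtoC t))].
- intros n. unfold bcoef. field. apply RtoC_INR_fact_neq_0.
- intros H. apply Ht0, RtoC_inj, H.
- now rewrite Cmod_R.
Qed.

Lemma one_lt_2PI : (1 < 2 * PI)%R.
Proof. pose proof PI2_3_2. unfold PI2 in *. lra. Qed.

(** Replacing z by z + w multiplies the generating function by exp(wt). With z = 0 this exhibits B_n
    as a polynomial, which is what makes it differentiable. *)
Lemma bcoef_translate (B : nat -> C -> C) (hB : is_bernoulli B) (z w : C) (n : nat) :
  bcoef B (z + w) n = sum_n (fun k => bcoef B z k * ecoef w (n - k)) n.
Proof.
revert n.
apply (Cpower_series_coef_unique (bcoef B (z + w))
  (fun n => sum_n (fun k => bcoef B z k * ecoef w (n - k)) n) 1 Rlt_0_1).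
intros t Ht0 Ht. pose proof one_lt_2PI as Hpi.
eexists. split; [apply bernoulli_series_real; auto; lra|].
replace (RtoC t * Cexp ((z + w) * RtoC t) / (Cexp (RtoC t) - 1))
  with (RtoC t * Cexp (z * RtoC t) / (Cexp (RtoC t) - 1) * Cexp (w * RtoC t)).
- apply is_Cseries_Cauchy_product with 1%R; auto.
  + eexists. apply (bernoulli_series_real B hB); [lra | rewrite Rabs_R1; lra].
  + eexists. apply is_Cseries_exp.
  + apply bernoulli_series_real; auto; lra.
  + apply is_Cseries_exp.
- replace ((z + w) * RtoC t) with (z * RtoC t + w * RtoC t) by ring.
  rewrite Cexp_plus. field. now apply Cexp_RtoC_neq_1.
Qed.

(** The difference of the two generating functions is t exp(zt), because exp(t) - 1 cancels; the
    factor t shifts the index by one. *)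
Lemma bcoef_difference (B : nat -> C -> C) (hB : is_bernoulli B) (z : C) (n : nat) :
  bcoef B (z + 1) n - bcoef B z n =
  match n with O => 0 | S m => ecoef z m end.
Proof.
revert n.
apply (Cpower_series_coef_unique (fun n => bcoef B (z + 1) n - bcoef B z n)
  (fun n => match n with O => 0 | S m => ecoef z m end) 1 Rlt_0_1).
intros t Ht0 Ht. pose proof one_lt_2PI as Hpi.
exists (RtoC t * Cexp (z * RtoC t)). split.
- replace (RtoC t * Cexp (z * RtoC t)) with
    (RtoC t * Cexp ((z + 1) * RtoC t) / (Cexp (RtoC t) - 1)
     - RtoC t * Cexp (z * RtoC t) / (Cexp (RtoC t) - 1)).
  + eapply is_Cseries_ext;
      [|apply is_Cseries_minus; apply (bernoulli_series_real B hB); auto; lra].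
    intros n. cbv beta. ring.
  + replace ((z + 1) * RtoC t) with (z * RtoC t + RtoC t) by ring.
    rewrite Cexp_plus. field. now apply Cexp_RtoC_neq_1.
- replace (RtoC t * Cexp (z * RtoC t)) with (RtoC t * Cexp (z * RtoC t) + 0 * RtoC t ^ 0) by ring.
  apply (is_Cseries_shift (fun n => match n with O => 0 | S m => ecoef z m end * RtoC t ^ n)).
  eapply is_Cseries_ext; [|apply is_Cseries_scal, is_Cseries_exp].
  intros n. cbv beta. rewrite Cpow_S. ring.
Qed.

(** The difference is a positive power of 0. Index at least 2 matters, since B_1 increases by 1 from
    0 to 1. *)
Lemma bcoef_at_1_0 (B : nat -> C -> C) (hB : is_bernoulli B) (n : nat) :
  bcoef B 1 (S (S n)) = bcoef B 0 (S (S n)).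
Proof.
assert (H := bcoef_difference B hB 0 (S (S n))). cbv beta iota in H.
rewrite Cplus_0_l in H. unfold ecoef in H. rewrite Cpow_S in H.
transitivity (bcoef B 1 (S (S n)) - bcoef B 0 (S (S n)) + bcoef B 0 (S (S n))); [ring|].
rewrite H. unfold Cdiv. ring.
Qed.

(** The generating function takes the same value at (1 - z, t) and at (z, -t). *)
Lemma bcoef_reflection (B : nat -> C -> C) (hB : is_bernoulli B) (z : C) (n : nat) :
  bcoef B (1 - z) n = (-1) ^ n * bcoef B z n.
Proof.
revert n.
apply (Cpower_series_coef_unique (bcoef B (1 - z)) (fun n => (-1) ^ n * bcoef B z n) 1 Rlt_0_1).
intros t Ht0 Ht. pose proof one_lt_2PI as Hpi.
eexists. split; [apply (bernoulli_series_real B hB); auto; lra|].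
replace (RtoC t * Cexp ((1 - z) * RtoC t) / (Cexp (RtoC t) - 1)) with
  (RtoC (- t) * Cexp (z * RtoC (- t)) / (Cexp (RtoC (- t)) - 1)).
- eapply is_Cseries_ext; [|apply (bernoulli_series_real B hB); [lra|rewrite Rabs_Ropp; lra]].
  intros n. cbv beta. replace (RtoC (- t)) with ((-1) * RtoC t) by (rewrite RtoC_opp; ring).
  rewrite Cpow_mult_l. ring.
- assert (N1 := Cexp_RtoC_neq_1 t Ht0).
  assert (N2 := Cexp_RtoC_neq_1 (- t) ltac:(lra)).
  replace ((1 - z) * RtoC t) with (RtoC t + z * RtoC (- t)) by (rewrite RtoC_opp; ring).
  rewrite Cexp_plus.
  assert (E : Cexp (RtoC t) * Cexp (RtoC (- t)) = 1).
  { rewrite <- Cexp_plus, <- RtoC_plus, Cexp_RtoC, Rplus_opp_r, exp_0. reflexivity. }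
  set (a := Cexp (RtoC t)) in *. set (b := Cexp (RtoC (- t))) in *.
  set (w := Cexp (z * RtoC (- t))). rewrite RtoC_opp.
  assert (a <> 0) by (intros H; rewrite H, Cmult_0_l in E; now apply RtoC_inj, eq_sym, R1_neq_R0 in E).
  assert (Eb : b = / a) by (rewrite <- (Cmult_1_r (/ a)), <- E; field; auto).
  rewrite Eb in *. field. repeat split; auto.
  intros H1. apply N1. transitivity (- (1 - a)); [ring|]. rewrite H1. ring.
Qed.

Lemma bcoef_real (B : nat -> C -> C) (hB : is_bernoulli B) (y : R) (n : nat) :
  bcoef B (RtoC y) n = RtoC (Re (bcoef B (RtoC y) n)).
Proof.
revert n.
apply (Cpower_series_coef_unique (bcoef B (RtoC y))
  (fun n => RtoC (Re (bcoef B (RtoC y) n))) 1 Rlt_0_1).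
intros t Ht0 Ht. pose proof one_lt_2PI as Hpi.
assert (H := bernoulli_series_real B hB (RtoC y) t Ht0 ltac:(lra)).
exists (RtoC t * Cexp (RtoC y * RtoC t) / (Cexp (RtoC t) - 1)). split; [exact H|].
set (l := RtoC t * Cexp (RtoC y * RtoC t) / (Cexp (RtoC t) - 1)) in *.
assert (El : l = RtoC (t * exp (y * t) / (exp t - 1))).
{ unfold l. rewrite <- RtoC_mult, !Cexp_RtoC, RtoC_div, RtoC_minus, RtoC_mult; [reflexivity|].
  intros H1. apply Ht0, exp_inv. rewrite exp_0. lra. }
apply is_Cseries_real_var in H. destruct H as [H _].
apply is_Cseries_real_var. split; [exact H|].
rewrite El. simpl. apply is_pseries_R in H. apply is_pseries_R.
(* Subtracting the series from itself produces the zero series needed for the imaginary parts. *)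
assert (H0 : is_series (fun n => Re (bcoef B y n) * t ^ n - Re (bcoef B y n) * t ^ n)%R
  (Re l - Re l)%R) by exact (is_series_minus _ _ _ _ H H).
rewrite Rminus_diag in H0. eapply is_series_ext; [|exact H0].
intros n. simpl. ring.
Qed.

(** * Complex derivatives *)

(** K |h|^2 <= eps |h| as soon as |h| < eps / (|K| + 1). Such a quadratic estimate can also be
    summed term by term over a power series. *)
Lemma is_Cderive_of_quadratic_remainder (f : C -> C) (z l : C) (delta K : R) :
  (0 < delta)%R ->
  (forall h : C, (Cmod h < delta)%R ->
     (Cmod (f (z + h)%C - f z - h * l) <= K * Cmod h ^ 2)%R) ->
  is_Cderive f z l.
Proof.
intros Hd H. split; [apply is_linear_scal_l|].
intros x Hx.
assert (Ex : z = x)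
  by exact (is_filter_lim_locally_unique (V := AbsRing_NormedModule C_AbsRing) z x Hx).
subst x. intros eps.
set (d := Rmin delta (eps / (Rabs K + 1))).
assert (HK := Rabs_pos K). assert (He := cond_pos eps).
assert (Hd' : (0 < d)%R).
{ apply Rmin_glb_lt; auto. apply Rdiv_lt_0_compat; lra. }
exists (mkposreal d Hd'). intros w Hw. revert w Hw.
change (forall w : C, (Cmod (w - z) < d)%R ->
  (Cmod (f w - f z - (w - z) * l) <= eps * Cmod (w - z))%R).
intros w Hw.
assert (H1 : (Cmod (w - z) < delta)%R) by (apply Rlt_le_trans with d; [auto|apply Rmin_l]).
assert (H2 : (Cmod (w - z) < eps / (Rabs K + 1))%R) by (apply Rlt_le_trans with d; [auto|apply Rmin_r]).
specialize (H (w - z) H1). replace (z + (w - z)) with w in H by ring.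
apply Rle_trans with (1 := H).
assert (H0 := Cmod_ge_0 (w - z)).
apply Rle_trans with ((Rabs K + 1) * Cmod (w - z) ^ 2)%R.
- apply Rmult_le_compat_r; [apply pow2_ge_0|]. pose proof (Rle_abs K). lra.
- simpl. rewrite Rmult_1_r, <- Rmult_assoc. apply Rmult_le_compat_r; auto.
  rewrite Rmult_comm. apply Rle_div_r; lra.
Qed.

Lemma is_Cderive_real_restriction (f : C -> C) (x : R) (l : C) :
  is_Cderive f (RtoC x) l -> is_derive (fun y : R => Re (f (RtoC y))) x (Re l).
Proof.
intros [_ H]. split; [apply is_linear_scal_l|].
intros x' Hx.
assert (Ex : x = x')
  by exact (is_filter_lim_locally_unique (V := R_NormedModule) x x' Hx).
subst x'. specialize (H (RtoC x) (fun P HP => HP)).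
intros eps. destruct (H eps) as [d Hd]. exists d. intros y Hy.
specialize (Hd (RtoC y)).
change (Rabs (Re (f (RtoC y)) - Re (f (RtoC x)) - (y - x) * Re l) <= eps * Rabs (y - x))%R.
rewrite <- (Cmod_R (y - x)), RtoC_minus.
apply Rle_trans with (Cmod (f (RtoC y) - f (RtoC x) - (RtoC y - RtoC x) * l)).
- apply Rle_trans with (2 := re_le_Cmod _). right. f_equal.
  unfold Re, Cminus, Cplus, Copp, Cmult, RtoC. simpl. ring.
- apply Hd. change (Cmod (RtoC y - RtoC x) < d)%R.
  rewrite <- RtoC_minus, Cmod_R. exact Hy.
Qed.

(** Induction on E_{n+1} = (z + h) E_n + n z^{n-1} h^2, closed by n^2 + n <= (n + 1)^2. The factor
    rho^2 on the left stands for an exponent n - 2 on the right. *)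
Lemma Cpow_quadratic_remainder (z h : C) (rho : R) (n : nat) :
  (Cmod z <= rho)%R -> (Cmod (z + h) <= rho)%R ->
  (Cmod ((z + h) ^ n - z ^ n - h * (RtoC (INR n) * z ^ pred n)) * rho ^ 2
   <= INR n ^ 2 * rho ^ n * Cmod h ^ 2)%R.
Proof.
intros Hz Hzh. assert (Hz0 := Cmod_ge_0 z). assert (H0 := Cmod_ge_0 h).
induction n as [|n IH].
- simpl. replace (1 - 1 - h * (0 * 1)) with (RtoC 0) by ring.
  rewrite Cmod_0. lra.
- replace ((z + h) ^ S n - z ^ S n - h * (RtoC (INR (S n)) * z ^ pred (S n))) with
   ((z + h) * ((z + h) ^ n - z ^ n - h * (RtoC (INR n) * z ^ pred n))
    + RtoC (INR n) * z ^ pred n * h ^ 2).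
  2: { rewrite S_INR, RtoC_plus. destruct n as [|n]; simpl pred; rewrite ?Cpow_S; simpl; ring. }
  set (E := (z + h) ^ n - z ^ n - h * (RtoC (INR n) * z ^ pred n)) in *.
  assert (HE := Cmod_ge_0 E).
  assert (H1 : (Cmod (RtoC (INR n) * z ^ pred n * h ^ 2) * rho ^ 2
     <= INR n * rho ^ S n * Cmod h ^ 2)%R).
  { rewrite !Cmod_mult, !Cmod_pow, Cmod_R, Rabs_pos_eq by apply pos_INR.
    destruct n as [|n]; [simpl; lra|]. simpl pred.
    replace (INR (S n) * Cmod z ^ n * Cmod h ^ 2 * rho ^ 2)%R with
      (INR (S n) * Cmod h ^ 2 * rho ^ 2 * Cmod z ^ n)%R by ring.
    replace (INR (S n) * rho ^ S (S n) * Cmod h ^ 2)%R with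
      (INR (S n) * Cmod h ^ 2 * rho ^ 2 * rho ^ n)%R by (simpl; ring).
    apply Rmult_le_compat_l; [|now apply pow_incr].
    apply Rmult_le_pos; [apply Rmult_le_pos; [apply pos_INR|]|]; apply pow2_ge_0. }
  assert (H2 : (Cmod ((z + h) * E) * rho ^ 2 <= rho * (INR n ^ 2 * rho ^ n * Cmod h ^ 2))%R).
  { rewrite Cmod_mult, Rmult_assoc. apply Rmult_le_compat; auto.
    - apply Cmod_ge_0.
    - apply Rmult_le_pos; [auto|apply pow2_ge_0]. }
  apply Rle_trans with ((Cmod ((z + h) * E) + Cmod (RtoC (INR n) * z ^ pred n * h ^ 2)) * rho ^ 2)%R.
  { apply Rmult_le_compat_r; [apply pow2_ge_0|apply Cmod_triangle]. }
  rewrite Rmult_plus_distr_r.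
  assert (H3 : (0 <= INR n * rho ^ S n * Cmod h ^ 2)%R).
  { apply Rmult_le_pos; [apply Rmult_le_pos|apply pow2_ge_0];
     [apply pos_INR|apply pow_le; lra]. }
  assert (H4 : (0 <= rho ^ S n * Cmod h ^ 2)%R).
  { apply Rmult_le_pos; [apply pow_le; lra|apply pow2_ge_0]. }
  rewrite S_INR.
  replace ((INR n + 1) ^ 2 * rho ^ S n * Cmod h ^ 2)%R with
   (rho * (INR n ^ 2 * rho ^ n * Cmod h ^ 2) + INR n * rho ^ S n * Cmod h ^ 2
    + (INR n * rho ^ S n * Cmod h ^ 2 + rho ^ S n * Cmod h ^ 2))%R by (simpl; ring).
  lra.
Qed.

Lemma is_Cderive_pow (z : C) (n : nat) :
  is_Cderive (fun w => w ^ n) z (RtoC (INR n) * z ^ pred n).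
Proof.
set (rho := (Cmod z + 1)%R). assert (Hz := Cmod_ge_0 z).
assert (Hr : (0 < rho ^ 2)%R) by (apply pow_lt; unfold rho; lra).
apply is_Cderive_of_quadratic_remainder with 1%R (INR n ^ 2 * rho ^ n / rho ^ 2)%R; [lra|].
intros h Hh. apply Rmult_le_reg_r with (rho ^ 2)%R; auto.
apply Rle_trans with (INR n ^ 2 * rho ^ n * Cmod h ^ 2)%R.
- apply Cpow_quadratic_remainder; unfold rho; [lra|].
  apply Rle_trans with (1 := Cmod_triangle _ _). lra.
- right. field. unfold rho. lra.
Qed.

Lemma is_Cderive_unique (f : C -> C) (z l m : C) :
  is_Cderive f z l -> is_Cderive f z m -> l = m.
Proof.
intros Hl Hm. rewrite <- (is_C_derive_unique f z l Hl). now apply is_C_derive_unique.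
Qed.

Lemma is_Cderive_ext (f g : C -> C) (z l : C) :
  (forall w, f w = g w) -> is_Cderive f z l -> is_Cderive g z l.
Proof. intros H. now apply is_derive_ext. Qed.

Lemma is_Cderive_scal (a : C) (f : C -> C) (z l : C) :
  is_Cderive f z l -> is_Cderive (fun w => a * f w) z (a * l).
Proof.
intros H. eapply filterdiff_ext_lin.
- exact (filterdiff_scal_r_fct (U := AbsRing_NormedModule C_AbsRing)
    (V := C_NormedModule) a f _ Cmult_comm H).
- intros y. change (a * (y * l) = y * (a * l)). ring.
Qed.

Lemma is_Cderive_minus (f g : C -> C) (z l m : C) :
  is_Cderive f z l -> is_Cderive g z m -> is_Cderive (fun w => f w - g w) z (l - m).
Proof. intros Hf Hg. exact (is_derive_minus _ _ _ _ _ Hf Hg). Qed.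

Lemma is_Cderive_const (a z : C) : is_Cderive (fun _ => a) z 0.
Proof. exact (is_derive_const (K := C_AbsRing) (V := C_NormedModule) a z). Qed.

Lemma is_Cderive_shift (f : C -> C) (a z l : C) :
  is_Cderive f (z + a) l -> is_Cderive (fun w => f (w + a)) z l.
Proof.
intros H.
assert (D : @is_derive C_AbsRing (AbsRing_NormedModule C_AbsRing) (fun w : C => w + a) z (RtoC 1)).
{ rewrite <- (Cplus_0_r (RtoC 1)).
  apply (is_derive_plus (K := C_AbsRing) (V := AbsRing_NormedModule C_AbsRing) (fun w => w) (fun _ => a)).
  - exact (is_derive_id (K := C_AbsRing) z).
  - exact (is_derive_const (K := C_AbsRing) (V := AbsRing_NormedModule C_AbsRing) a z). }
assert (H' := is_derive_comp (K := C_AbsRing) f (fun w : C => w + a) z _ _ H D).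
rewrite <- (Cmult_1_l l). exact H'.
Qed.

Lemma is_Cderive_ecoef (z : C) (n : nat) :
  is_Cderive (fun w => ecoef w (S n)) z (ecoef z n).
Proof.
assert (H := is_Cderive_scal (/ RtoC (INR (fact (S n)))) _ _ _ (is_Cderive_pow z (S n))).
replace (ecoef z n) with (/ RtoC (INR (fact (S n))) * (RtoC (INR (S n)) * z ^ pred (S n))).
- revert H. apply is_Cderive_ext. intros w. unfold ecoef, Cdiv. ring.
- unfold ecoef. rewrite RtoC_INR_fact_S. simpl pred. field.
  split; [apply RtoC_INR_fact_neq_0 | apply RtoC_INR_S_neq_0].
Qed.

Lemma is_Cderive_bcoef (B : nat -> C -> C) (hB : is_bernoulli B) (z : C) (n : nat) :
  is_Cderive (fun w => bcoef B w (S n)) z (bcoef B z n).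
Proof.
apply is_Cderive_ext with
  (fun w => sum_n (fun k => bcoef B 0 k * ecoef w (S n - k)) (S n)).
{ intros w. rewrite <- (bcoef_translate B hB). f_equal. ring. }
rewrite <- (Cplus_0_l z) at 2. rewrite (bcoef_translate B hB 0 z n).
(* The term with k = S n is constant in w, so the list of derivatives is padded by a 0 there. *)
set (d := fun k => if Nat.eq_dec k (S n) then RtoC 0 else bcoef B 0 k * ecoef z (n - k)).
replace (sum_n (fun k => bcoef B 0 k * ecoef z (n - k)) n) with (sum_n d (S n)).
- apply (is_derive_sum_n (K := C_AbsRing) (V := C_NormedModule)
    (fun k w => bcoef B 0 k * ecoef w (S n - k)) (S n) z d).
  intros k Hk. unfold d. destruct (Nat.eq_dec k (S n)) as [->|Hne].
  + rewrite Nat.sub_diag. apply (is_Cderive_const (bcoef B 0 (S n) * ecoef 0 0)).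
  + replace (S n - k)%nat with (S (n - k)) by lia.
    apply is_Cderive_scal, is_Cderive_ecoef.
- rewrite sum_Sn. unfold d at 2. destruct (Nat.eq_dec (S n) (S n)) as [_|]; [|lia].
  transitivity (sum_n d n); [exact (Cplus_0_r (sum_n d n))|]. apply sum_n_ext_loc. intros k Hk.
  unfold d. destruct (Nat.eq_dec k (S n)); [lia|reflexivity].
Qed.

(** By translation from 0, B_1(1) - B_1(0) equals the constant B_0, while the difference equation
    gives it the value 1. *)
Lemma bernoulli_0 (B : nat -> C -> C) (hB : is_bernoulli B) (z : C) : B 0%nat z = 1.
Proof.
assert (HT : forall w n, bcoef B w n = sum_n (fun k => bcoef B 0 k * ecoef w (n - k)) n).
{ intros w n. rewrite <- (bcoef_translate B hB). f_equal. ring. }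
assert (H := bcoef_difference B hB 0 1).
rewrite (HT (0 + 1)), (HT 0), !sum_Sn, !sum_O in H.
assert (H0 := HT z 0%nat). rewrite sum_O in H0.
rewrite bernoulli_bcoef, H0.
change (bcoef B 0 0 * ecoef (0 + 1) 1 + bcoef B 0 1 * ecoef (0 + 1) 0
  - (bcoef B 0 0 * ecoef 0 1 + bcoef B 0 1 * ecoef 0 0) = ecoef 0 0) in H.
unfold ecoef in *. simpl in *. transitivity (bcoef B 0 0); [field|].
transitivity (bcoef B 0 0 * ((0 + 1) * 1 / 1) + bcoef B 0 1 * (1 / 1) -
    (bcoef B 0 0 * (0 * 1 / 1) + bcoef B 0 1 * (1 / 1))); [field|].
rewrite H. field.
Qed.

Lemma is_Cderive_Ssum (B : nat -> C -> C) (hB : is_bernoulli B) (n : nat) (z : C) :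
  is_Cderive (Ssum B n) z (B n (z + 1)).
Proof.
apply is_Cderive_ext with (fun w => RtoC (INR (fact n)) *
   (bcoef B (w + 1) (S n) - bcoef B 1 (S n))).
- intros w. unfold Ssum, bernoulli_number, bcoef.
  rewrite Nat.add_1_r, RtoC_INR_fact_S. field.
  split; [apply RtoC_INR_S_neq_0 | apply RtoC_INR_fact_neq_0].
- replace (B n (z + 1)) with (RtoC (INR (fact n)) * (bcoef B (z + 1) n - 0))
    by (rewrite bernoulli_bcoef; ring).
  apply is_Cderive_scal, is_Cderive_minus; [|apply is_Cderive_const].
  apply (is_Cderive_shift (fun w => bcoef B w (S n))), (is_Cderive_bcoef B hB).
Qed.

(** Uniqueness of the complex derivative forces the existential [dS n] to be B_n(z + 1). *)
Lemma is_sigma'_iff (B : nat -> C -> C) (hB : is_bernoulli B) (c : nat -> C) (z l : C) :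
  is_sigma' B c z l <-> is_Cseries (fun n => c n * B n (z + 1)) l.
Proof.
split.
- intros [dS [HdS H]]. eapply is_Cseries_ext; [|exact H].
  intros n. cbv beta. f_equal. apply (is_Cderive_unique (Ssum B n) z); auto.
  now apply is_Cderive_Ssum.
- intros H. exists (fun n => B n (z + 1)). split; auto.
  intros n. now apply is_Cderive_Ssum.
Qed.

(** * Complex power series and Abel's test *)

Lemma in_disk_le (r : Rbar) (z w : C) :
  (Cmod w <= Cmod z)%R -> in_disk r z -> in_disk r w.
Proof. intros H Hz. exact (Rbar_le_lt_trans (Cmod w) (Cmod z) r H Hz). Qed.

Lemma exists_larger_in_disk (r : Rbar) (z : C) :
  in_disk r z -> exists R : R, (Cmod z < R)%R /\ in_disk r (RtoC R).
Proof.
unfold in_disk. intros H. assert (H0 := Cmod_ge_0 z).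
destruct r as [r| |]; simpl in H; [|exists (Cmod z + 1)%R|easy].
- exists ((Cmod z + r) / 2)%R. rewrite Cmod_R, Rabs_pos_eq by lra. simpl. lra.
- split; [lra|]. now simpl.
Qed.

Lemma power_series_coef_unique (r : Rbar) (a b : nat -> C) (g : C -> C) :
  in_disk r 0 -> power_series_on r a g -> power_series_on r b g -> forall n, a n = b n.
Proof.
intros hr Ha Hb. destruct (exists_larger_in_disk r 0 hr) as [R [HR1 HR2]].
rewrite Cmod_0 in HR1.
apply (Cpower_series_coef_unique a b R HR1). intros t _ Ht. exists (g (RtoC t)).
assert (D : in_disk r (RtoC t)).
{ apply in_disk_le with (2 := HR2). rewrite !Cmod_R, (Rabs_pos_eq R); lra. }
split; [apply Ha | apply Hb]; exact D.
Qed.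

Lemma Cmod_le_Re_Im (z : C) : (Cmod z <= Rabs (Re z) + Rabs (Im z))%R.
Proof.
replace z with (RtoC (Re z) + Ci * RtoC (Im z)) at 1.
- apply Rle_trans with (1 := Cmod_triangle _ _).
  rewrite Cmod_mult, Cmod_Ci, !Cmod_R. lra.
- destruct z as [x y]. unfold Re, Im, Ci, RtoC, Cmult, Cplus. simpl. f_equal; ring.
Qed.

Lemma ex_Cseries_dominated (u : nat -> C) (v : nat -> R) :
  (forall n, (Cmod (u n) <= v n)%R) -> ex_series v -> exists l, is_Cseries u l.
Proof.
intros Hu Hv.
assert (H1 : ex_series (fun n => Re (u n))).
{ apply (ex_series_le (V := R_CompleteNormedModule) _ v); auto.
  intros n. apply Rle_trans with (2 := Hu n). apply re_le_Cmod. }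
assert (H2 : ex_series (fun n => Im (u n))).
{ apply (ex_series_le (V := R_CompleteNormedModule) _ v); auto.
  intros n. apply Rle_trans with (2 := Hu n). apply Im_le_Cmod. }
exists (CSeries u). apply is_Cseries_Re_Im. split; now apply Series_correct.
Qed.

(** The factor 2 comes from bounding real and imaginary parts separately; it only enlarges the
    constant of a quadratic remainder. *)
Lemma Cmod_Cseries_le (u : nat -> C) (v : nat -> R) (l : C) :
  (forall n, (Cmod (u n) <= v n)%R) -> ex_series v -> is_Cseries u l ->
  (Cmod l <= 2 * Series v)%R.
Proof.
intros Hu Hv Hl. apply is_Cseries_Re_Im in Hl. destruct Hl as [H1 H2].
assert (HB : forall a s, (forall n, (Rabs (a n) <= v n)%R) -> is_series a s ->
   (Rabs s <= Series v)%R).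
{ intros a s Ha Hs. rewrite <- (is_series_unique _ _ Hs).
  assert (Hx : ex_series (fun n => Rabs (a n))).
  { apply (ex_series_le (V := R_CompleteNormedModule) _ v); auto.
    intros n. change (Rabs (Rabs (a n)) <= v n)%R. rewrite Rabs_Rabsolu. apply Ha. }
  apply Rle_trans with (1 := Series_Rabs _ Hx). apply Series_le; auto.
  intros n. split; [apply Rabs_pos|apply Ha]. }
apply Rle_trans with (1 := Cmod_le_Re_Im l).
apply HB in H1; [apply HB in H2|]; [lra| |]; intros n; apply Rle_trans with (2 := Hu n);
  [apply Im_le_Cmod | apply re_le_Cmod].
Qed.

(* [PS_incr_1 (PS_derive a)] has coefficients [n * a n]. *)
Lemma ex_series_square_weight (a : nat -> R) (rho : R) :
  (0 <= rho)%R -> Rbar_lt rho (CV_radius a) ->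
  ex_series (fun n => INR n ^ 2 * Rabs (a n) * rho ^ n)%R.
Proof.
intros H0 H.
assert (E : ex_series (fun n =>
  Rabs (PS_incr_1 (PS_derive (PS_incr_1 (PS_derive a))) n * rho ^ n))).
{ apply CV_disk_inside.
  rewrite CV_radius_incr_1, CV_radius_derive, CV_radius_incr_1, CV_radius_derive.
  now rewrite Rabs_pos_eq. }
revert E. apply ex_series_ext. intros n.
assert (E : PS_incr_1 (PS_derive (PS_incr_1 (PS_derive a))) n = (INR n ^ 2 * a n)%R).
{ destruct n as [|n].
  - change (0 = 0 ^ 2 * a 0%nat)%R. ring.
  - change (INR (S n) * (INR (S n) * a (S n)) = INR (S n) ^ 2 * a (S n))%R. ring. }
rewrite E, !Rabs_mult, (Rabs_pos_eq (INR n ^ 2)), (Rabs_pos_eq (rho ^ n)); auto.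
- now apply pow_le.
- apply pow2_ge_0.
Qed.

(** With |z| < rho < R, the one summable weight n^2 |c_n| rho^n dominates both the differentiated
    series and the quadratic remainders of all powers. *)
Lemma is_Cderive_power_series (r : Rbar) (c : nat -> C) (f : C -> C)
  (hf : power_series_on r c f) (z : C) : in_disk r z ->
  exists l : C, is_Cseries (fun n => RtoC (INR (S n)) * c (S n) * z ^ n) l /\
    is_Cderive f z l.
Proof.
intros hz. destruct (exists_larger_in_disk r z hz) as [R [HR1 HR2]].
assert (Hz0 := Cmod_ge_0 z).
set (rho := ((Cmod z + R) / 2)%R).
assert (Hrho : (Cmod z < rho < R)%R) by (unfold rho; lra).
assert (Hrho2 : (0 < rho ^ 2)%R) by (apply pow_lt; lra).
set (W := fun n => (INR n ^ 2 * Cmod (c n) * rho ^ n)%R).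
assert (HW : ex_series W).
{ assert (H := hf (RtoC R) HR2). apply is_Cseries_real_var in H. destruct H as [H1 H2].
  assert (C1 := CV_radius_ge _ R (ex_intro _ _ H1)).
  assert (C2 := CV_radius_ge _ R (ex_intro _ _ H2)).
  rewrite Rabs_pos_eq in C1, C2 by lra.
  assert (S1 := ex_series_square_weight _ rho ltac:(lra)
     (Rbar_lt_le_trans rho R _ (proj2 Hrho) C1)).
  assert (S2 := ex_series_square_weight _ rho ltac:(lra)
     (Rbar_lt_le_trans rho R _ (proj2 Hrho) C2)).
  apply (ex_series_le (V := R_CompleteNormedModule) W _) with (2 := ex_series_plus _ _ S1 S2).
  intros n. change (Rabs (W n) <= INR n ^ 2 * Rabs (Re (c n)) * rho ^ n
     + INR n ^ 2 * Rabs (Im (c n)) * rho ^ n)%R.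
  assert (P1 : (0 <= INR n ^ 2 * rho ^ n)%R).
  { apply Rmult_le_pos; [apply pow2_ge_0 | apply pow_le; lra]. }
  unfold W. replace (INR n ^ 2 * Cmod (c n) * rho ^ n)%R
    with (INR n ^ 2 * rho ^ n * Cmod (c n))%R by ring.
  rewrite Rabs_pos_eq by (apply Rmult_le_pos; [auto | apply Cmod_ge_0]).
  apply Rle_trans with (INR n ^ 2 * rho ^ n * (Rabs (Re (c n)) + Rabs (Im (c n))))%R;
    [|right; ring].
  apply Rmult_le_compat_l; [auto | apply Cmod_le_Re_Im]. }
assert (HW' : ex_series (fun n => / rho * W n)%R) by exact (ex_series_scal_l (/ rho)%R W HW).
set (d := fun n => c n * (RtoC (INR n) * z ^ pred n)).
destruct (ex_Cseries_dominated d (fun n => / rho * W n)%R) as [l Hl]; auto.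
{ intros n. unfold d, W. rewrite !Cmod_mult, Cmod_pow, Cmod_R, Rabs_pos_eq by apply pos_INR.
  destruct n as [|n]; [simpl; lra|]. simpl pred.
  replace (/ rho * (INR (S n) ^ 2 * Cmod (c (S n)) * rho ^ S n))%R with
   (Cmod (c (S n)) * (INR (S n) ^ 2 * rho ^ n))%R by (simpl; field; lra).
  apply Rmult_le_compat_l; [apply Cmod_ge_0|].
  apply Rmult_le_compat; [apply pos_INR | apply pow_le; lra | | apply pow_incr; lra].
  assert (H1 : (1 <= INR (S n))%R) by (rewrite S_INR; pose proof (pos_INR n); lra).
  generalize dependent (INR (S n)). intros x Hx. nra. }
exists l. split.
- apply is_Cseries_ext with (fun n => d (S n)); [intros n; unfold d; simpl pred; ring|].
  apply is_Cseries_shift. replace (l + d 0%nat) with l; [exact Hl|].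
  unfold d. simpl. ring.
(* The radius rho - |z| keeps z + h within rho. In the constant, 2 comes from [Cmod_Cseries_le] and
   rho^2 from [Cpow_quadratic_remainder]. *)
- apply is_Cderive_of_quadratic_remainder with (rho - Cmod z)%R (2 * Series W / rho ^ 2)%R; [lra|].
  intros h Hh.
  assert (Hzh : (Cmod (z + h) <= rho)%R).
  { apply Rle_trans with (1 := Cmod_triangle _ _). lra. }
  assert (Dzh : in_disk r (z + h)).
  { apply in_disk_le with (2 := HR2). rewrite Cmod_R, Rabs_pos_eq by lra. lra. }
  assert (HS := is_Cseries_minus _ _ _ _ (is_Cseries_minus _ _ _ _ (hf _ Dzh) (hf _ hz))
    (is_Cseries_scal h _ _ Hl)).
  apply Rle_trans with (2 * Series (fun n => Cmod h ^ 2 / rho ^ 2 * W n))%R.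
  + apply Cmod_Cseries_le with (3 := HS); [|exact (ex_series_scal_l _ W HW)].
    intros n. unfold d.
    replace (c n * (z + h) ^ n - c n * z ^ n - h * (c n * (RtoC (INR n) * z ^ pred n)))
      with (c n * ((z + h) ^ n - z ^ n - h * (RtoC (INR n) * z ^ pred n))) by ring.
    rewrite Cmod_mult.
    apply Rmult_le_reg_r with (rho ^ 2)%R; auto.
    assert (HP := Cpow_quadratic_remainder z h rho n ltac:(lra) Hzh).
    apply (Rmult_le_compat_l (Cmod (c n))) in HP; [|apply Cmod_ge_0].
    rewrite Rmult_assoc. apply Rle_trans with (1 := HP).
    right. unfold W. field. lra.
  + rewrite Series_scal_l. right. field. lra.
Qed.

(** After summation by parts, the bounded partial sums of x multiply the nonnegative decrements of
    y, whose series telescopes. *)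
Lemma ex_series_Abel_decreasing (x y : nat -> R) (m : R) :
  ex_series x -> (forall n, y (S n) <= y n)%R -> (forall n, m <= y n)%R ->
  ex_series (fun n => x n * y n)%R.
Proof.
intros [s Hs] Hdec Hm.
destruct (ex_finite_lim_seq_decr y m Hdec Hm) as [ly Hly].
assert (Hs' : is_lim_seq (sum_n x) s) by exact Hs.
destruct (maj_by_pos (sum_n x)) as [K [HK0 HK]].
{ exists s. now apply is_lim_seq_Reals. }
assert (Htel : ex_series (fun n => K * (y n - y (S n)))%R).
{ apply (ex_series_scal_l K (fun n => y n - y (S n))%R). exists (y 0%nat - ly)%R.
  apply (is_lim_seq_ext (fun n => y 0%nat - y (S n))%R (sum_n _) (Finite (y 0%nat - ly)%R)).
  - induction n as [|n IH]; [now rewrite sum_O|]. rewrite sum_Sn, <- IH.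
    change (y 0%nat - y (S (S n)) = y 0%nat - y (S n) + (y (S n) - y (S (S n))))%R. ring.
  - apply is_lim_seq_minus'; [apply is_lim_seq_const | now apply is_lim_seq_incr_1 in Hly]. }
assert (Hsum : ex_series (fun n => sum_n x n * (y n - y (S n)))%R).
{ apply (ex_series_le (V := R_CompleteNormedModule)) with (2 := Htel).
  intros n. change (Rabs (sum_n x n * (y n - y (S n))) <= K * (y n - y (S n)))%R.
  specialize (Hdec n). rewrite Rabs_mult, (Rabs_pos_eq (_ - _)) by lra.
  apply Rmult_le_compat_r; [lra|apply HK]. }
destruct Hsum as [l Hl].
exists (s * ly + l)%R.
(* The exact identity: the partial sum of x_k y_k is X_n y_{n+1} plus the sum of X_k (y_k -
   y_{k+1}), where X_n denotes the partial sums of x. *)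
apply (is_lim_seq_ext (fun n => sum_n x n * y (S n) +
   sum_n (fun n => sum_n x n * (y n - y (S n))) n)%R (sum_n _) (Finite (s * ly + l)%R)).
- induction n as [|n IH].
  + rewrite !sum_O. ring.
  + rewrite (sum_Sn (fun n => sum_n x n * (y n - y (S n)))%R), (sum_Sn (fun n => x n * y n)%R), <- IH, sum_Sn.
    change plus with Rplus. ring.
- apply is_lim_seq_plus'; [|exact Hl].
  apply is_lim_seq_mult'; [exact Hs'|]. now apply is_lim_seq_incr_1 in Hly.
Qed.

Lemma ex_Cseries_Abel_decreasing (x : nat -> C) (y : nat -> R) (m : R) :
  (exists l, is_Cseries x l) ->
  (forall n, y (S n) <= y n)%R -> (forall n, m <= y n)%R ->
  exists l, is_Cseries (fun n => x n * RtoC (y n)) l.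
Proof.
intros [l Hl] Hdec Hm. apply is_Cseries_Re_Im in Hl. destruct Hl as [H1 H2].
destruct (ex_series_Abel_decreasing _ y m (ex_intro _ _ H1) Hdec Hm) as [l1 L1].
destruct (ex_series_Abel_decreasing _ y m (ex_intro _ _ H2) Hdec Hm) as [l2 L2].
exists (l1, l2). apply is_Cseries_Re_Im. split.
- eapply is_series_ext; [|exact L1]. intros n. unfold Re, Cmult, RtoC. simpl. ring.
- eapply is_series_ext; [|exact L2]. intros n. unfold Im, Cmult, RtoC. simpl. ring.
Qed.

Lemma ex_Cseries_Abel_increasing (x : nat -> C) (y : nat -> R) (m : R) :
  (exists l, is_Cseries x l) ->
  (forall n, y n <= y (S n))%R -> (forall n, y n <= m)%R ->
  exists l, is_Cseries (fun n => x n * RtoC (y n)) l.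
Proof.
intros Hx Hinc Hm.
destruct (ex_Cseries_Abel_decreasing x (fun n => - y n)%R (- m)%R Hx) as [l Hl].
- intros n. apply Ropp_le_contravar, Hinc.
- intros n. apply Ropp_le_contravar, Hm.
- exists (-1 * l). eapply is_Cseries_ext; [|apply is_Cseries_scal, Hl].
  intros n. cbv beta. rewrite RtoC_opp. ring.
Qed.

(** * Cyclic Appell families *)

(* A function on the circle [0, 1] that is smooth off the two points 0 and s is
   encoded by its restrictions f1 to [0, s] and f2 to [s, 1]. *)
Definition circle_inner (s : R) (f1 f2 g1 g2 : R -> R) : R :=
  (RInt (fun y => f1 y * g1 y) 0 s + RInt (fun y => f2 y * g2 y) s 1)%R.

(** Matching at the break points (0 identified with 1, and s) is demanded only from index 2 on:
    index 1 may jump, as the sawtooth B_1 does. *)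
Definition circle_appell (s : R) (p q : nat -> R -> R) : Prop :=
  (forall n y, is_derive (p (S n)) y (p n y)) /\
  (forall n y, is_derive (q (S n)) y (q n y)) /\
  (forall n, p (S (S n)) 0%R = q (S (S n)) 1%R /\ p (S (S n)) s = q (S (S n)) s).

Lemma ex_RInt_continuous_mult (f g : R -> R) (a b : R) :
  (forall y, continuous f y) -> (forall y, continuous g y) ->
  ex_RInt (fun y => f y * g y)%R a b.
Proof.
intros Hf Hg. apply (ex_RInt_continuous (V := R_CompleteNormedModule)).
intros y _. now apply (continuous_mult (K := R_AbsRing)).
Qed.

Lemma is_derive_continuous (f df : R -> R) (y : R) :
  is_derive f y (df y) -> continuous f y.
Proof.
intros H. apply (ex_derive_continuous (K := R_AbsRing) (V := R_NormedModule)).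
now exists (df y).
Qed.

Lemma RInt_by_parts (f df g dg : R -> R) (a b : R) :
  (forall y, is_derive f y (df y)) -> (forall y, is_derive g y (dg y)) ->
  (forall y, continuous df y) -> (forall y, continuous dg y) ->
  (RInt (fun y => df y * g y) a b + RInt (fun y => f y * dg y) a b
   = f b * g b - f a * g a)%R.
Proof.
intros Hf Hg Cf Cg.
assert (Cf' : forall y, continuous f y) by (intros y; now apply is_derive_continuous with df).
assert (Cg' : forall y, continuous g y) by (intros y; now apply is_derive_continuous with dg).
etransitivity; [symmetry; apply (RInt_plus (V := R_CompleteNormedModule));
  now apply ex_RInt_continuous_mult|].
apply is_RInt_unique.
apply (is_RInt_derive (V := R_CompleteNormedModule) (fun y => f y * g y)%R
  (fun y => plus (df y * g y) (f y * dg y))%R).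
- intros y _. apply (is_derive_mult f g y _ _ (Hf y) (Hg y)). intros; apply Rmult_comm.
- intros y _. apply (continuous_plus (K := R_AbsRing) (V := R_NormedModule)
    (fun y => df y * g y)%R (fun y => f y * dg y)%R);
    now apply (continuous_mult (K := R_AbsRing)).
Qed.

Lemma circle_appell_continuous (s : R) (p q : nat -> R -> R) (n : nat) (y : R) :
  circle_appell s p q -> continuous (p (S n)) y /\ continuous (q (S n)) y.
Proof.
intros [Hp [Hq _]]. split.
- apply is_derive_continuous with (p n), Hp.
- apply is_derive_continuous with (q n), Hq.
Qed.

(** Integration by parts on both arcs. The boundary terms involve only indices at least 2, hence
    match at the break points and cancel around the circle. *)
Lemma circle_inner_shift (s : R) (p q e f : nat -> R -> R) (n m : nat) :
  circle_appell s p q -> circle_appell s e f ->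
  circle_inner s (p (S (S n))) (q (S (S n))) (e (S m)) (f (S m)) =
  (- circle_inner s (p (S n)) (q (S n)) (e (S (S m))) (f (S (S m))))%R.
Proof.
intros Hp He.
assert (Cp := fun n y => circle_appell_continuous s p q n y Hp).
assert (Ce := fun n y => circle_appell_continuous s e f n y He).
destruct Hp as [Dp [Dq Hpq]]. destruct He as [De [Df Hef]].
assert (I1 := RInt_by_parts _ _ _ _ 0 s (Dp (S n)) (De (S m))
  (fun y => proj1 (Cp n y)) (fun y => proj1 (Ce m y))).
assert (I2 := RInt_by_parts _ _ _ _ s 1 (Dq (S n)) (Df (S m))
  (fun y => proj2 (Cp n y)) (fun y => proj2 (Ce m y))).
destruct (Hpq n) as [E1 E2]. destruct (Hef m) as [E3 E4].
unfold circle_inner. rewrite E1, E2, E3, E4 in I1. lra.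
Qed.

(** The total index is preserved while the left one drops to 1, where the Bernoulli families are
    affine on each arc and the integral is explicit. *)
Lemma circle_inner_iterate (s : R) (p q e f : nat -> R -> R) (j k : nat) :
  circle_appell s p q -> circle_appell s e f ->
  circle_inner s (p (S j)) (q (S j)) (e (S k)) (f (S k)) =
  ((-1) ^ j * circle_inner s (p 1%nat) (q 1%nat) (e (S (j + k))) (f (S (j + k))))%R.
Proof.
intros Hp He. revert k. induction j as [|j IH]; intros k.
- simpl. ring.
- rewrite circle_inner_shift by assumption. rewrite IH.
  replace (j + S k)%nat with (S j + k)%nat by lia. simpl pow. ring.
Qed.

Lemma circle_inner_square_nonneg (s : R) (f1 f2 : R -> R) :
  (0 <= s <= 1)%R -> (forall y, continuous f1 y) -> (forall y, continuous f2 y) ->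
  (0 <= circle_inner s f1 f2 f1 f2)%R.
Proof.
intros Hs H1 H2. unfold circle_inner.
apply Rplus_le_le_0_compat; apply RInt_ge_0; try lra;
  try (now apply ex_RInt_continuous_mult); intros y _; apply Rle_0_sqr.
Qed.

Lemma RInt_square_plus_scal (f g : R -> R) (l a b : R) :
  (forall y, continuous f y) -> (forall y, continuous g y) ->
  RInt (fun y => (f y + l * g y) * (f y + l * g y))%R a b =
  (RInt (fun y => f y * f y) a b + 2 * l * RInt (fun y => f y * g y) a b
   + l ^ 2 * RInt (fun y => g y * g y) a b)%R.
Proof.
intros Hf Hg. apply is_RInt_unique.
assert (Iff := RInt_correct _ _ _ (ex_RInt_continuous_mult f f a b Hf Hf)).
assert (Ifg := RInt_correct _ _ _ (ex_RInt_continuous_mult f g a b Hf Hg)).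
assert (Igg := RInt_correct _ _ _ (ex_RInt_continuous_mult g g a b Hg Hg)).
eapply is_RInt_ext; [|apply (is_RInt_plus (V := R_NormedModule)
  _ _ _ _ _ _ (is_RInt_plus (V := R_NormedModule) _ _ _ _ _ _ Iff
    (is_RInt_scal (V := R_NormedModule) _ _ _ (2 * l)%R _ Ifg))
    (is_RInt_scal (V := R_NormedModule) _ _ _ (l ^ 2)%R _ Igg))].
intros y _. change (f y * f y + 2 * l * (f y * g y) + l ^ 2 * (g y * g y)
  = (f y + l * g y) * (f y + l * g y))%R. ring.
Qed.

Lemma discriminant_le (a b c : R) :
  (0 <= c)%R -> (forall l : R, 0 <= a + 2 * l * b + l ^ 2 * c)%R -> (b ^ 2 <= a * c)%R.
Proof.
intros Hc H. destruct (Rle_lt_or_eq_dec 0 c Hc) as [Hc'|<-].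
- specialize (H (- b / c)%R).
  apply (Rmult_le_compat_r c) in H; [|lra].
  replace ((a + 2 * (- b / c) * b + (- b / c) ^ 2 * c) * c)%R
    with (a * c - b ^ 2)%R in H by (field; lra). lra.
- destruct (Req_dec b 0) as [->|Hb]; [lra|].
  (* For c = 0 the expression is affine in l; this l gives it the value -1. *)
  specialize (H (- (a + 1) / (2 * b))%R).
  replace (a + 2 * (- (a + 1) / (2 * b)) * b + (- (a + 1) / (2 * b)) ^ 2 * 0)%R
    with (-1)%R in H by (field; lra). lra.
Qed.

Lemma circle_Cauchy_Schwarz (s : R) (f1 f2 g1 g2 : R -> R) :
  (0 <= s <= 1)%R ->
  (forall y, continuous f1 y) -> (forall y, continuous f2 y) ->
  (forall y, continuous g1 y) -> (forall y, continuous g2 y) ->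
  (circle_inner s f1 f2 g1 g2 ^ 2
   <= circle_inner s f1 f2 f1 f2 * circle_inner s g1 g2 g1 g2)%R.
Proof.
intros Hs Hf1 Hf2 Hg1 Hg2. apply discriminant_le.
- now apply circle_inner_square_nonneg.
- intros l.
  assert (Hc : forall f g : R -> R, (forall y, continuous f y) -> (forall y, continuous g y) ->
    forall y, continuous (fun y => f y + l * g y)%R y).
  { intros f g Hf Hg y. apply (continuous_plus (K := R_AbsRing) (V := R_NormedModule) f); auto.
    now apply (continuous_scal_r (K := R_AbsRing) (V := R_NormedModule) l g). }
  assert (H := circle_inner_square_nonneg s _ _ Hs (Hc f1 g1 Hf1 Hg1) (Hc f2 g2 Hf2 Hg2)).
  unfold circle_inner in *. rewrite !RInt_square_plus_scal in H by assumption. lra.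
Qed.

(** Energy number m belongs to index m + 1, the first index for which [circle_appell] yields
    continuity. For the Bernoulli family it therefore leads to b_{2m+2}. *)
Definition appell_energy (s : R) (p q : nat -> R -> R) (m : nat) : R :=
  circle_inner s (p (S m)) (q (S m)) (p (S m)) (q (S m)).

Lemma appell_energy_nonneg (s : R) (p q : nat -> R -> R) (m : nat) :
  (0 <= s <= 1)%R -> circle_appell s p q -> (0 <= appell_energy s p q m)%R.
Proof.
intros Hs H. apply circle_inner_square_nonneg; auto; intros y;
  apply (circle_appell_continuous s p q m y H).
Qed.

(** One integration by parts turns the middle squared norm into minus the pairing of its two
    neighbours, to which Cauchy-Schwarz applies. *)
Lemma appell_energy_log_convex (s : R) (p q : nat -> R -> R) (m : nat) :
  (0 <= s <= 1)%R -> circle_appell s p q ->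
  (appell_energy s p q (S m) ^ 2
   <= appell_energy s p q m * appell_energy s p q (S (S m)))%R.
Proof.
intros Hs H. unfold appell_energy at 1. rewrite circle_inner_shift by assumption.
replace ((- _) ^ 2)%R with
  (circle_inner s (p (S m)) (q (S m)) (p (S (S (S m)))) (q (S (S (S m)))) ^ 2)%R by ring.
apply circle_Cauchy_Schwarz; auto; intros y;
 first [apply (circle_appell_continuous s p q m y H)
       |apply (circle_appell_continuous s p q (S (S m)) y H)].
Qed.

(* If the ratio [a (m+1) / a m] ever exceeded [/ L ^ 2], log-convexity would
   preserve it, contradicting the subexponential growth of [a m * L ^ (2 m)]. *)
Lemma log_convex_nonincreasing (a : nat -> R) (L : R) :
  (0 < L)%R -> (forall m, 0 <= a m)%R ->
  (forall m, a (S m) ^ 2 <= a m * a (S (S m)))%R ->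
  (forall t, 0 < t < L -> is_lim_seq (fun m => a m * t ^ (2 * m)) 0)%R ->
  forall m, (a (S m) * L ^ (2 * S m) <= a m * L ^ (2 * m))%R.
Proof.
intros HL Hpos Hconv Hlim M.
replace (a (S M) * L ^ (2 * S M))%R with (a (S M) * L ^ 2 * L ^ (2 * M))%R
  by (replace (2 * S M)%nat with (2 + 2 * M)%nat by lia; rewrite pow_add; ring).
apply Rmult_le_compat_r; [apply pow_le; lra|].
apply Rnot_lt_le. intros Hlt.
assert (Hp0 := Hpos M).
assert (HL2 : (0 < L ^ 2)%R) by now apply pow_lt.
assert (H1 : (0 < a (S M))%R).
{ apply Rmult_lt_reg_r with (L ^ 2)%R; lra. }
assert (H0 : (0 < a M)%R).
{ destruct (Rle_lt_or_eq_dec _ _ Hp0) as [|E]; auto.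
  specialize (Hconv M). rewrite <- E, Rmult_0_l in Hconv.
  assert (0 < a (S M) ^ 2)%R by now apply pow_lt. lra. }
set (k := (a (S M) / a M)%R).
assert (Hk : (0 < k)%R) by now apply Rdiv_lt_0_compat.
assert (Hstep : forall j, (0 < a (M + j)%nat /\ k * a (M + j)%nat <= a (S (M + j)))%R).
{ induction j as [|j [IH1 IH2]].
  - rewrite Nat.add_0_r. split; auto. right. unfold k. field. lra.
  - rewrite Nat.add_succ_r. assert (P : (0 < a (S (M + j)))%R).
    { apply Rlt_le_trans with (2 := IH2). now apply Rmult_lt_0_compat. }
    split; auto. apply Rmult_le_reg_l with (a (M + j)%nat); auto.
    apply Rle_trans with (2 := Hconv (M + j)%nat).
    replace (a (M + j)%nat * (k * a (S (M + j))))%R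
      with (k * a (M + j)%nat * a (S (M + j)))%R by ring.
    simpl pow. rewrite Rmult_1_r. apply Rmult_le_compat_r; lra. }
(* At t^2 = 1/k the growth by the ratio k is exactly balanced, so a_m t^{2m} cannot decrease from M
   on; and t < L because k L^2 > 1. *)
set (t := sqrt (/ k)).
assert (Ht0 : (0 < t)%R) by now apply sqrt_lt_R0, Rinv_0_lt_compat.
assert (Ht2 : (t ^ 2 = / k)%R).
{ unfold t. rewrite pow2_sqrt; auto. left. now apply Rinv_0_lt_compat. }
assert (HtL : (t < L)%R).
{ apply Rnot_le_lt. intros H. assert (L ^ 2 <= t ^ 2)%R by (apply pow_incr; lra).
  rewrite Ht2 in H2. apply (Rmult_le_compat_l (a (S M))) in H2; [|lra].
  replace (a (S M) * / k)%R with (a M) in H2 by (unfold k; field; lra). lra. }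
assert (Hlow : forall j, (a M * t ^ (2 * M) <= a (M + j)%nat * t ^ (2 * (M + j)))%R).
{ induction j as [|j IH]; [rewrite Nat.add_0_r; lra|].
  apply Rle_trans with (1 := IH). rewrite Nat.add_succ_r.
  replace (2 * S (M + j))%nat with (2 + 2 * (M + j))%nat by lia.
  rewrite pow_add, Ht2, <- Rmult_assoc.
  apply Rmult_le_compat_r; [apply pow_le; lra|].
  apply Rmult_le_reg_l with k; auto. replace (k * (a (S (M + j)) * / k))%R
   with (a (S (M + j))) by (field; lra). apply Hstep. }
assert (Hl := Hlim t (conj Ht0 HtL)).
apply (is_lim_seq_incr_n _ M) in Hl.
assert (Hle : Rbar_le (a M * t ^ (2 * M))%R 0%R).
{ apply (is_lim_seq_le (fun _ => a M * t ^ (2 * M))%R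
    (fun j => a (j + M)%nat * t ^ (2 * (j + M)))%R); auto.
  - intros j. rewrite (Nat.add_comm j M). apply Hlow.
  - apply is_lim_seq_const. }
change (a M * t ^ (2 * M) <= 0)%R in Hle.
assert (0 < a M * t ^ (2 * M))%R by (apply Rmult_lt_0_compat; auto; now apply pow_lt).
lra.
Qed.

(** * Bernoulli functions on the circle *)

Definition rbern (B : nat -> C -> C) (n : nat) (y : R) : R := Re (bcoef B (RtoC y) n).

(* The periodized Bernoulli function subtracted from its translate by x, with break point 1 - x:
   [bern_jump1] on [0, 1 - x] and [bern_jump2] on [1 - x, 1]. *)
Definition bern_jump1 (B : nat -> C -> C) (x : R) (n : nat) (y : R) : R :=
  (rbern B n (y + x) - rbern B n y)%R.

Definition bern_jump2 (B : nat -> C -> C) (x : R) (n : nat) (y : R) : R :=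
  (rbern B n (y + (x - 1)) - rbern B n y)%R.

(** cos(2 pi y) integrated n times: each integration divides by 2 pi and turns the phase back by
    pi/2. *)
Definition harmonic (n : nat) (y : R) : R :=
  (cos (2 * PI * y - INR n * (PI / 2)) / (2 * PI) ^ n)%R.

Lemma is_derive_rbern (B : nat -> C -> C) (hB : is_bernoulli B) (n : nat) (y : R) :
  is_derive (rbern B (S n)) y (rbern B n y).
Proof.
exact (is_Cderive_real_restriction (fun w => bcoef B w (S n)) y _
  (is_Cderive_bcoef B hB (RtoC y) n)).
Qed.

Lemma rbern_0 (B : nat -> C -> C) (hB : is_bernoulli B) (y : R) : rbern B 0 y = 1%R.
Proof.
unfold rbern, bcoef. rewrite (bernoulli_0 B hB). simpl. field.
Qed.

(** The constant term is left unevaluated: it cancels in translates minus the function and around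
    the full circle. *)
Lemma rbern_1 (B : nat -> C -> C) (hB : is_bernoulli B) (y : R) :
  rbern B 1 y = (y + rbern B 1 0)%R.
Proof.
assert (H := derive_zero_constant (fun y => rbern B 1 y - y)%R y).
cbv beta in H. rewrite Rminus_0_r in H. rewrite <- H; [ring|].
intros s. replace 0%R with (minus (rbern B 0 s) one).
- apply (is_derive_minus (K := R_AbsRing) (V := R_NormedModule) (rbern B 1) (fun y => y)).
  + now apply is_derive_rbern.
  + exact (is_derive_id (K := R_AbsRing) s).
- rewrite (rbern_0 B hB). change (1 - 1 = 0)%R. ring.
Qed.

Lemma rbern_periodic (B : nat -> C -> C) (hB : is_bernoulli B) (n : nat) :
  rbern B (S (S n)) 1 = rbern B (S (S n)) 0.
Proof. exact (f_equal Re (bcoef_at_1_0 B hB n)). Qed.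

Lemma is_derive_shift (f df : R -> R) (a y : R) :
  (forall z, is_derive f z (df z)) -> is_derive (fun y => f (y + a)%R) y (df (y + a)%R).
Proof.
intros H. auto_derive.
- eexists. apply H.
- rewrite Rmult_1_l. apply is_derive_unique, H.
Qed.

Lemma circle_appell_rbern (B : nat -> C -> C) (hB : is_bernoulli B) (s : R) :
  circle_appell s (rbern B) (rbern B).
Proof.
assert (D := is_derive_rbern B hB).
split; [exact D|split; [exact D|]]. intros n. split; [|reflexivity].
symmetry. now apply rbern_periodic.
Qed.

Lemma circle_appell_jump (B : nat -> C -> C) (hB : is_bernoulli B) (x : R) :
  circle_appell (1 - x) (bern_jump1 B x) (bern_jump2 B x).
Proof.
assert (D := is_derive_rbern B hB).
assert (HD : forall a n y, is_derive (fun y => rbern B (S n) (y + a) - rbern B (S n) y)%R y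
  (rbern B n (y + a) - rbern B n y)%R).
{ intros a n y. apply (is_derive_minus (K := R_AbsRing) (V := R_NormedModule)
    (fun y => rbern B (S n) (y + a))%R (rbern B (S n))); auto.
  apply (is_derive_shift _ (rbern B n)), D. }
split; [|split].
- intros n y. apply HD.
- intros n y. apply HD.
- intros n. assert (P := rbern_periodic B hB n). unfold bern_jump1, bern_jump2.
  replace (1 + (x - 1))%R with (0 + x)%R by ring.
  replace (1 - x + x)%R with 1%R by ring.
  replace (1 - x + (x - 1))%R with 0%R by ring. lra.
Qed.

Lemma circle_appell_harmonic (s : R) : circle_appell s harmonic harmonic.
Proof.
assert (Hpi := PI_RGT_0).
assert (D : forall n y, is_derive (harmonic (S n)) y (harmonic n y)).
{ intros n y. unfold harmonic. auto_derive; [auto|].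
  change (match n with O => 1 | S _ => INR n + 1 end)%R with (INR (S n)).
  rewrite S_INR.
  replace (2 * PI * y + - ((INR n + 1) * (PI / 2)))%R
    with (- (PI / 2 - (2 * PI * y - INR n * (PI / 2))))%R by field.
  rewrite sin_neg, sin_shift. field. split; [apply pow_nonzero|]; lra. }
split; [exact D|split; [exact D|]]. intros n. split; [|reflexivity].
unfold harmonic. rewrite <- (cos_period _ 1).
do 2 f_equal. simpl INR. ring.
Qed.

Lemma RInt_appell (p : nat -> R -> R) (n : nat) (a b : R) :
  (forall n y, is_derive (p (S n)) y (p n y)) ->
  RInt (p (S n)) a b = (p (S (S n)) b - p (S (S n)) a)%R.
Proof.
intros D. apply is_RInt_unique.
apply (is_RInt_derive (V := R_CompleteNormedModule) (p (S (S n))) (p (S n))).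
- intros y _. apply D.
- intros y _. now apply is_derive_continuous with (p n).
Qed.

(** At index 1 the difference is the constant x on one arc and x - 1 on the other. Integrating and
    matching the end values leaves total weight 1 at 1 - x and -1 at 0. *)
Lemma circle_inner_jump_1 (B : nat -> C -> C) (hB : is_bernoulli B) (x : R)
  (e f : nat -> R -> R) (m : nat) :
  circle_appell (1 - x) e f ->
  circle_inner (1 - x) (bern_jump1 B x 1) (bern_jump2 B x 1) (e (S m)) (f (S m)) =
  (e (S (S m)) (1 - x) - e (S (S m)) 0)%R.
Proof.
intros He. assert (Ce := fun y => circle_appell_continuous _ e f m y He).
destruct He as [De [Df Hef]]. unfold circle_inner.
assert (E1 : RInt (fun y => bern_jump1 B x 1 y * e (S m) y)%R 0 (1 - x) =
  (x * RInt (e (S m)) 0 (1 - x))%R).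
{ rewrite <- (RInt_scal (V := R_CompleteNormedModule)).
  - apply RInt_ext. intros y _. unfold bern_jump1.
    rewrite (rbern_1 B hB y), (rbern_1 B hB (y + x)).
    change ((y + x + rbern B 1 0 - (y + rbern B 1 0)) * e (S m) y = x * e (S m) y)%R. ring.
  - apply (ex_RInt_continuous (V := R_CompleteNormedModule)). intros y _. apply Ce. }
assert (E2 : RInt (fun y => bern_jump2 B x 1 y * f (S m) y)%R (1 - x) 1 =
  ((x - 1) * RInt (f (S m)) (1 - x) 1)%R).
{ rewrite <- (RInt_scal (V := R_CompleteNormedModule)).
  - apply RInt_ext. intros y _. unfold bern_jump2.
    rewrite (rbern_1 B hB y), (rbern_1 B hB (y + (x - 1))).
    change ((y + (x - 1) + rbern B 1 0 - (y + rbern B 1 0)) * f (S m) y = (x - 1) * f (S m) y)%R. ring.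
  - apply (ex_RInt_continuous (V := R_CompleteNormedModule)). intros y _. apply Ce. }
rewrite E1, E2, (RInt_appell e), (RInt_appell f) by assumption.
destruct (Hef m) as [H1 H2]. rewrite <- H1, <- H2. ring.
Qed.

(** By parts with B_0 = 1: the remaining integral vanishes by periodicity, and the unit jump of B_1
    at 0 leaves one boundary value. *)
Lemma circle_inner_rbern_1 (B : nat -> C -> C) (hB : is_bernoulli B) (s : R) (m : nat) :
  circle_inner s (rbern B 1) (rbern B 1) (rbern B (S m)) (rbern B (S m)) =
  rbern B (S (S m)) 0.
Proof.
assert (D := is_derive_rbern B hB).
assert (C1 : forall n y, continuous (rbern B (S n)) y)
  by (intros n y; now apply is_derive_continuous with (rbern B n)).
assert (C0 : forall y, continuous (rbern B 0) y).
{ intros y. apply continuous_ext with (fun _ => 1%R); [intros; now rewrite rbern_0|].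
  apply continuous_const. }
assert (I : forall a b, (RInt (fun y => rbern B 1 y * rbern B (S m) y) a b =
  rbern B 1 b * rbern B (S (S m)) b - rbern B 1 a * rbern B (S (S m)) a
  - (rbern B (S (S (S m))) b - rbern B (S (S (S m))) a))%R).
{ intros a b.
  assert (H := RInt_by_parts _ _ _ _ a b (D 0%nat) (D (S m)) C0 (C1 m)).
  rewrite <- (RInt_appell (rbern B) (S m)) by exact D.
  rewrite (RInt_ext _ (rbern B (S (S m)))) in H; [lra|].
  intros y _. rewrite (rbern_0 B hB). apply Rmult_1_l. }
unfold circle_inner. rewrite !I, (rbern_1 B hB 1), !(rbern_periodic B hB). ring.
Qed.

Lemma energy_rbern (B : nat -> C -> C) (hB : is_bernoulli B) (s : R) (m : nat) :
  appell_energy s (rbern B) (rbern B) m = ((-1) ^ m * rbern B (2 * S m) 0)%R.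
Proof.
unfold appell_energy. rewrite circle_inner_iterate by now apply circle_appell_rbern.
rewrite (circle_inner_rbern_1 B hB). do 2 f_equal. lia.
Qed.

Lemma energy_jump (B : nat -> C -> C) (hB : is_bernoulli B) (x : R) (m : nat) :
  appell_energy (1 - x) (bern_jump1 B x) (bern_jump2 B x) m =
  ((-1) ^ m * (2 * rbern B (2 * S m) 0 - rbern B (2 * S m) x - rbern B (2 * S m) (1 - x)))%R.
Proof.
assert (HJ := circle_appell_jump B hB x).
unfold appell_energy. rewrite circle_inner_iterate by assumption.
rewrite (circle_inner_jump_1 B hB) by assumption.
replace (S (S (m + m))) with (2 * S m)%nat by lia. unfold bern_jump1.
replace (1 - x + x)%R with 1%R by ring.
replace (2 * S m)%nat with (S (S (2 * m))) at 1 by lia. rewrite (rbern_periodic B hB).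
replace (S (S (2 * m))) with (2 * S m)%nat by lia.
rewrite Rplus_0_l. ring.
Qed.

Lemma rbern_growth (B : nat -> C -> C) (hB : is_bernoulli B) (y t : R) :
  (0 < t < 2 * PI)%R -> is_lim_seq (fun n => rbern B n y * t ^ n)%R 0.
Proof.
intros Ht.
assert (H := bernoulli_series_real B hB (RtoC y) t ltac:(lra)
  ltac:(rewrite Rabs_pos_eq; lra)).
apply is_Cseries_real_var in H. destruct H as [H _]. apply is_pseries_R in H.
apply ex_series_lim_0. eexists. exact H.
Qed.

Lemma even_subsequence_growth (a v : nat -> R) (t : R) :
  (0 < t)%R -> (forall m, a m = Rabs (v (2 * S m)%nat)) ->
  is_lim_seq (fun n => v n * t ^ n)%R 0 ->
  is_lim_seq (fun m => a m * t ^ (2 * m))%R 0.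
Proof.
intros Ht Ha Hv.
assert (Hsub : is_lim_seq (fun m => v (2 * S m)%nat * t ^ (2 * S m))%R 0).
{ apply (is_lim_seq_subseq (fun n => v n * t ^ n)%R 0 (fun m => 2 * S m)%nat); auto.
  apply eventually_subseq. intros n. lia. }
apply is_lim_seq_abs_0 in Hsub.
(* Energy number m involves index 2m + 2, so a factor t^2 is divided out. *)
apply (is_lim_seq_scal_l _ (/ t ^ 2)) in Hsub. simpl Rbar_mult in Hsub.
rewrite Rmult_0_r in Hsub. revert Hsub. apply is_lim_seq_ext. intros m.
assert (0 < t ^ 2)%R by now apply pow_lt.
rewrite Ha, Rabs_mult, (Rabs_pos_eq (t ^ _)) by (apply pow_le; lra).
replace (2 * S m)%nat with (2 + 2 * m)%nat at 2 by lia. rewrite pow_add. field. lra.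
Qed.

(** Nonnegativity of the energies absorbs the alternating sign, so the growth of the Bernoulli
    values carries over in absolute value. *)
Lemma Rabs_pow_opp_1_mult (m : nat) (u v : R) :
  (u = (-1) ^ m * v)%R -> (0 <= u)%R -> u = Rabs v.
Proof.
intros E H. rewrite <- (Rabs_pos_eq u H), E, Rabs_mult, pow_1_abs. ring.
Qed.

Lemma energy_rbern_nonincreasing (B : nat -> C -> C) (hB : is_bernoulli B) (s : R) (m : nat) :
  (0 <= s <= 1)%R ->
  (appell_energy s (rbern B) (rbern B) (S m) * (2 * PI) ^ (2 * S m)
   <= appell_energy s (rbern B) (rbern B) m * (2 * PI) ^ (2 * m))%R.
Proof.
intros Hs. assert (HA := circle_appell_rbern B hB s). assert (Hpi := PI_RGT_0).
apply (log_convex_nonincreasing (appell_energy s (rbern B) (rbern B))); try lra.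
- intros k. now apply appell_energy_nonneg.
- intros k. now apply appell_energy_log_convex.
- intros t Ht. apply even_subsequence_growth with (v := fun n => rbern B n 0); try lra.
  + intros k. apply Rabs_pow_opp_1_mult with k; [now apply energy_rbern|].
    now apply appell_energy_nonneg.
  + now apply rbern_growth.
Qed.

Lemma energy_jump_nonincreasing (B : nat -> C -> C) (hB : is_bernoulli B) (x : R) (m : nat) :
  (0 <= x <= 1)%R ->
  (appell_energy (1 - x) (bern_jump1 B x) (bern_jump2 B x) (S m) * (2 * PI) ^ (2 * S m)
   <= appell_energy (1 - x) (bern_jump1 B x) (bern_jump2 B x) m * (2 * PI) ^ (2 * m))%R.
Proof.
intros Hx. assert (HA := circle_appell_jump B hB x). assert (Hpi := PI_RGT_0).
apply (log_convex_nonincreasing (appell_energy (1 - x) (bern_jump1 B x) (bern_jump2 B x)));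
  try lra.
- intros k. apply appell_energy_nonneg; auto; lra.
- intros k. apply appell_energy_log_convex; auto; lra.
- intros t Ht. apply even_subsequence_growth with
   (v := fun n => (2 * rbern B n 0 - rbern B n x - rbern B n (1 - x))%R); try lra.
  + intros k. apply Rabs_pow_opp_1_mult with k; [now apply energy_jump|].
    apply appell_energy_nonneg; auto; lra.
  + assert (G := fun y => rbern_growth B hB y t Ht).
    replace (Finite 0) with (Finite (2 * 0 - 0 - 0)) by (f_equal; ring).
    apply is_lim_seq_ext with (fun n => 2 * (rbern B n 0 * t ^ n) - rbern B n x * t ^ n
       - rbern B n (1 - x) * t ^ n)%R; [intros n; ring|].
    apply is_lim_seq_minus'; [apply is_lim_seq_minus'|]; auto.
    exact (is_lim_seq_scal_l _ 2%R _ (G 0%R)).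
Qed.

Lemma energy_harmonic_le (s : R) (m : nat) :
  (0 <= s <= 1)%R ->
  (appell_energy s harmonic harmonic m <= / (2 * PI) ^ (2 * S m))%R.
Proof.
intros Hs. assert (HA := circle_appell_harmonic s). assert (Hpi := PI_RGT_0).
set (M := (/ (2 * PI) ^ (2 * S m))%R).
assert (Hb : forall y, (harmonic (S m) y * harmonic (S m) y <= M)%R).
{ intros y. unfold harmonic, M. set (th := (2 * PI * y - INR (S m) * (PI / 2))%R).
  replace (2 * S m)%nat with (S m + S m)%nat by lia. rewrite pow_add.
  assert (Hp : (0 < (2 * PI) ^ S m)%R) by (apply pow_lt; lra).
  set (P := ((2 * PI) ^ S m)%R) in *.
  assert (Hc := COS_bound th).
  replace (cos th / P * (cos th / P))%R with (cos th * cos th * / (P * P))%R by (field; lra).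
  rewrite <- (Rmult_1_l (/ (P * P))) at 2. apply Rmult_le_compat_r.
  - left. apply Rinv_0_lt_compat. nra.
  - nra. }
assert (Hi : forall a b, (a <= b)%R ->
  (RInt (fun y => harmonic (S m) y * harmonic (S m) y) a b <= (b - a) * M)%R).
{ intros a b Hab. change ((b - a) * M)%R with (scal (b - a)%R M).
  rewrite <- (RInt_const (V := R_CompleteNormedModule)).
  apply RInt_le; auto.
  - apply ex_RInt_continuous_mult; intros y; apply (circle_appell_continuous s _ _ m y HA).
  - apply ex_RInt_const. }
unfold appell_energy, circle_inner.
assert (H1 := Hi 0%R s ltac:(lra)). assert (H2 := Hi s 1%R ltac:(lra)). lra.
Qed.

(* Cauchy-Schwarz against the first harmonic. *)
Lemma energy_jump_lower_bound (B : nat -> C -> C) (hB : is_bernoulli B) (x : R) (m : nat) :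
  (0 <= x <= 1)%R ->
  ((1 - cos (2 * PI * x)) ^ 2 / (2 * PI) ^ 2 <=
   appell_energy (1 - x) (bern_jump1 B x) (bern_jump2 B x) m * (2 * PI) ^ (2 * m))%R.
Proof.
intros Hx. assert (HJ := circle_appell_jump B hB x).
assert (HH := circle_appell_harmonic (1 - x)). assert (Hpi := PI_RGT_0).
assert (CJ := fun y => circle_appell_continuous _ _ _ m y HJ).
assert (CH := fun y => circle_appell_continuous _ _ _ m y HH).
assert (HCS := circle_Cauchy_Schwarz (1 - x) _ _ _ _ ltac:(lra)
  (fun y => proj1 (CJ y)) (fun y => proj2 (CJ y))
  (fun y => proj1 (CH y)) (fun y => proj2 (CH y))).
rewrite circle_inner_iterate, (circle_inner_jump_1 B hB) in HCS by assumption.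
fold (appell_energy (1 - x) (bern_jump1 B x) (bern_jump2 B x) m) in HCS.
fold (appell_energy (1 - x) harmonic harmonic m) in HCS.
replace (S (S (m + m))) with (2 * S m)%nat in HCS by lia.
set (A := appell_energy (1 - x) (bern_jump1 B x) (bern_jump2 B x) m) in *.
assert (HA : (0 <= A)%R) by (apply appell_energy_nonneg; auto; lra).
assert (HE := energy_harmonic_le (1 - x) m ltac:(lra)).
set (L := ((2 * PI) ^ (2 * S m))%R) in *.
assert (HL : (0 < L)%R) by (apply pow_lt; lra).
assert (EH : (((-1) ^ m * (harmonic (2 * S m) (1 - x) - harmonic (2 * S m) 0)) ^ 2
  = (1 - cos (2 * PI * x)) ^ 2 / (L * L))%R).
{ unfold harmonic. fold L.
  (* At the even order 2(m + 1) the phase is a multiple of pi, so the harmonic is cos(2 pi y) / L up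
     to sign. *)
  assert (E : forall y, cos (2 * PI * y - INR (2 * S m) * (PI / 2)) =
     ((-1) ^ S m * cos (2 * PI * y))%R).
  { intros y. rewrite mult_INR. replace (2 * PI * y - INR 2 * INR (S m) * (PI / 2))%R
      with (2 * PI * y - INR (S m) * PI)%R by (simpl (INR 2); field).
    generalize (S m) as k. induction k as [|k IH].
    - simpl. rewrite Rmult_0_l, Rminus_0_r. ring.
    - rewrite S_INR.
      replace (2 * PI * y - (INR k + 1) * PI)%R with (- (PI - (2 * PI * y - INR k * PI)))%R by ring.
      rewrite cos_neg. rewrite Rtrigo_facts.cos_pi_minus, IH. simpl. ring. }
  rewrite !E, Rmult_0_r, cos_0.
  replace (2 * PI * (1 - x))%R with (- (2 * PI * x) + 2 * INR 1 * PI)%R by (simpl INR; ring).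
  rewrite cos_period, cos_neg.
  assert (S1 : ((-1) ^ m * (-1) ^ m = 1)%R).
  { rewrite <- Rpow_mult_distr. replace (-1 * -1)%R with 1%R by ring. apply pow1. }
  assert (S2 : ((-1) ^ S m * (-1) ^ S m = 1)%R).
  { rewrite <- Rpow_mult_distr. replace (-1 * -1)%R with 1%R by ring. apply pow1. }
  set (e1 := ((-1) ^ m)%R) in *. set (e2 := ((-1) ^ S m)%R) in *.
  transitivity ((e1 * e1) * (e2 * e2) * (1 - cos (2 * PI * x)) ^ 2 / (L * L))%R.
  - field. lra.
  - rewrite S1, S2. field. lra. }
rewrite EH in HCS.
(* Cauchy-Schwarz and the harmonic energy bound 1/L give (1 - cos)^2 / L^2 <= A / L. Multiplying by
   L^2 / (2 pi)^2 and using L = (2 pi)^2 (2 pi)^{2m} gives the claim. *)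
apply Rle_trans with (L * L * / (2 * PI) ^ 2 * ((1 - cos (2 * PI * x)) ^ 2 / (L * L)))%R.
{ right. field. split; lra. }
assert (HP : (0 < (2 * PI) ^ 2)%R) by (apply pow_lt; lra).
apply Rle_trans with (L * L * / (2 * PI) ^ 2 * (A * / L))%R.
- apply Rmult_le_compat_l.
  + apply Rmult_le_pos; [apply Rmult_le_pos; lra | left; now apply Rinv_0_lt_compat].
  + apply Rle_trans with (1 := HCS). now apply Rmult_le_compat_l.
- right. transitivity (A * (L / (2 * PI) ^ 2))%R; [field; split; lra|].
  f_equal. unfold L. replace (2 * S m)%nat with (2 + 2 * m)%nat by lia.
  rewrite pow_add. field. lra.
Qed.

(** * Recovering the series of the c_n b_n *)

(** With 0 < x < 1 the break point 1 - x lies inside the circle and 1 - cos(2 pi x) is positive, so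
    the lower energy bound is nontrivial. *)
Lemma exists_unit_in_disk (r : Rbar) :
  in_disk r 0 -> exists x : R, (0 < x < 1)%R /\ in_disk r (RtoC x).
Proof.
intros H. destruct (exists_larger_in_disk r 0 H) as [R [HR1 HR2]].
rewrite Cmod_0 in HR1. exists (Rmin R (1 / 2)).
assert (H1 := Rmin_l R (1 / 2)). assert (H2 := Rmin_r R (1 / 2)).
assert (H3 : (0 < Rmin R (1 / 2))%R) by (apply Rmin_glb_lt; lra).
split; [lra|]. apply in_disk_le with (2 := HR2). rewrite !Cmod_R, !Rabs_pos_eq; lra.
Qed.

Lemma Cpow_opp_1_odd (m : nat) : (-1) ^ S (2 * m) = -1.
Proof.
rewrite Cpow_S, Cpow_mult_r. replace ((-1) ^ 2) with (RtoC 1) by (simpl; ring).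
rewrite Cpow_1_l. ring.
Qed.

(** Reflection gives B_n(1) = -B_n(0) for odd n, periodicity gives B_n(1) = B_n(0). *)
Lemma bcoef_odd_at_1 (B : nat -> C -> C) (hB : is_bernoulli B) (m : nat) :
  bcoef B 1 (S (2 * S m)) = 0.
Proof.
assert (H := bcoef_reflection B hB 0 (S (2 * S m))).
replace (1 - 0) with (RtoC 1) in H by ring. rewrite Cpow_opp_1_odd in H.
replace (2 * S m)%nat with (S (S (2 * m))) in * by lia.
rewrite <- (bcoef_at_1_0 B hB) in H.
set (u := bcoef B 1 (S (S (S (2 * m))))) in *.
assert (E : u + u = 0) by (rewrite H at 1; ring).
transitivity ((u + u) / 2); [field; intros E2; apply RtoC_inj in E2; lra|].
rewrite E. unfold Cdiv. ring.
Qed.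

Lemma cos_2PI_lt_1 (x : R) : (0 < x < 1)%R -> (cos (2 * PI * x) < 1)%R.
Proof.
intros Hx. assert (Hpi := PI_RGT_0).
assert (Hs : (0 < sin (PI * x))%R) by (apply sin_gt_0; nra).
replace (2 * PI * x)%R with (2 * (PI * x))%R by ring.
rewrite cos_2a_sin. nra.
Qed.

(** For even k both sides come from energies with the same sign (-1)^m; the powers of 2 pi cancel
    and are inserted to make each factor monotone. [Nat.div2] extends the factors to odd k as
    constants on pairs, preserving monotonicity. *)
Lemma bernoulli_second_difference (B : nat -> C -> C) (hB : is_bernoulli B)
  (x : R) (k : nat) :
  (0 < x < 1)%R ->
  B (S (S k)) 1 =
  (2 * B (S (S k)) 1 - B (S (S k)) (RtoC x) - B (S (S k)) (1 - RtoC x)) *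
  RtoC (appell_energy (1 - x) (rbern B) (rbern B) (Nat.div2 k) * (2 * PI) ^ (2 * Nat.div2 k)) *
  RtoC (/ (appell_energy (1 - x) (bern_jump1 B x) (bern_jump2 B x) (Nat.div2 k)
     * (2 * PI) ^ (2 * Nat.div2 k))).
Proof.
intros Hx. rewrite !(bernoulli_bcoef B (S (S k))).
destruct (Nat.Even_or_Odd k) as [[m ->]|[m ->]].
- rewrite Nat.div2_double.
  assert (Hlow := energy_jump_lower_bound B hB x m ltac:(lra)).
  assert (Hpi := PI_RGT_0).
  assert (Hc := cos_2PI_lt_1 x Hx).
  assert (HA : (0 < (1 - cos (2 * PI * x)) ^ 2 / (2 * PI) ^ 2)%R).
  { apply Rdiv_lt_0_compat; apply pow_lt; lra. }
  assert (HP : (0 < (2 * PI) ^ (2 * m))%R) by (apply pow_lt; lra).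
  set (A := appell_energy (1 - x) (bern_jump1 B x) (bern_jump2 B x) m) in *.
  assert (HA0 : (A <> 0)%R) by (intros E; rewrite E in Hlow; lra).
  assert (EA := energy_jump B hB x m). fold A in EA.
  rewrite (energy_rbern B hB (1 - x) m).
  replace (S (S (2 * m))) with (2 * S m)%nat by lia.
  assert (E1 : bcoef B 1 (2 * S m) = RtoC (rbern B (2 * S m) 0)).
  { replace (2 * S m)%nat with (S (S (2 * m))) by lia. rewrite (bcoef_at_1_0 B hB).
    exact (bcoef_real B hB 0 _). }
  rewrite E1, <- RtoC_minus, (bcoef_real B hB x), (bcoef_real B hB (1 - x)).
  fold (rbern B (2 * S m) x) (rbern B (2 * S m) (1 - x)).
  set (u := rbern B (2 * S m) 0) in *.
  set (v := rbern B (2 * S m) x) in *. set (w := rbern B (2 * S m) (1 - x)) in *.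
  set (F := INR (fact (2 * S m))). set (P := ((2 * PI) ^ (2 * m))%R) in *.
  rewrite <- !RtoC_mult, <- !RtoC_minus, <- !RtoC_mult. f_equal.
  assert (S1 : ((-1) ^ m * (-1) ^ m = 1)%R).
  { rewrite <- Rpow_mult_distr. replace (-1 * -1)%R with 1%R by ring. apply pow1. }
  set (e := ((-1) ^ m)%R) in *.
  assert (ED : (2 * u - v - w = e * A)%R).
  { rewrite EA. rewrite <- (Rmult_1_l (2 * u - v - w)), <- S1 at 1. ring. }
  transitivity (F * (2 * u - v - w) * (e * u * P) * / (A * P))%R; [|ring].
  rewrite ED. transitivity (F * (e * e) * u)%R; [rewrite S1; ring|].
  field. lra.
(* Odd order: b_n vanishes, and the values at x and 1 - x cancel by reflection. *)
- replace (S (S (2 * m + 1))) with (S (2 * S m)) by lia.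
  rewrite (bcoef_reflection B hB), Cpow_opp_1_odd, (bcoef_odd_at_1 B hB). ring.
Qed.

Lemma Ssum_shifted (B : nat -> C -> C) (n : nat) (z : C) :
  RtoC (INR (1 + n)) * Ssum B (1 + n - 1) z = B (1 + n)%nat (z + 1) - B (1 + n)%nat 1.
Proof.
replace (1 + n - 1)%nat with n by lia. unfold Ssum, bernoulli_number.
rewrite Nat.add_1_r. change (1 + n)%nat with (S n).
field. apply RtoC_INR_S_neq_0.
Qed.

Lemma bernoulli_difference (B : nat -> C -> C) (hB : is_bernoulli B) (n : nat) (z : C) :
  B (S n) (z + 1) = B (S n) z + RtoC (INR (S n)) * z ^ n.
Proof.
rewrite !(bernoulli_bcoef B (S n)).
assert (H := bcoef_difference B hB z (S n)). cbv beta iota in H.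
replace (bcoef B (z + 1) (S n)) with (bcoef B z (S n) + ecoef z n) by (rewrite <- H; ring).
unfold ecoef. rewrite RtoC_INR_fact_S. field. apply RtoC_INR_fact_neq_0.
Qed.

Lemma bernoulli_numbers_summable (B : nat -> C -> C) (hB : is_bernoulli B)
  (r : Rbar) (hr : in_disk r 0) (c : nat -> C) (f : C -> C) (hf : power_series_on r c f) :
  (forall z : C, in_disk r z ->
    ex_Cseries_from 1 (fun n => RtoC (INR n) * c n * Ssum B (n - 1) z)) ->
  exists l : C, is_Cseries (fun n => c n * B n 1) l.
Proof.
intros Hc. destruct (exists_unit_in_disk r hr) as [x [Hx Dx]].
assert (Dx' : in_disk r (- RtoC x)) by (apply in_disk_le with (2 := Dx); rewrite Cmod_opp; lra).
destruct (Hc _ Dx) as [l1 L1]. destruct (Hc _ Dx') as [l2 L2].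
destruct (is_Cderive_power_series r c f hf (RtoC x) Dx) as [l3 [L3 _]].
unfold is_Cseries_from in L1, L2.
set (X := fun n => c n * (2 * B n 1 - B n (RtoC x) - B n (1 - RtoC x))).
(* At x the difference equation replaces B_n(1 + x) by B_n(x) + n x^{n-1}; [L3] removes the power.
   At -x the argument is already 1 - x. *)
assert (HX1 : is_Cseries (fun n => X (S n)) (-1 * (l1 + l2 - l3))).
{ eapply is_Cseries_ext; [|apply is_Cseries_scal, is_Cseries_minus;
    [apply is_Cseries_plus; [exact L1 | exact L2] | exact L3]].
  intros n. cbv beta.
  transitivity (-1 * (c (S n) * (RtoC (INR (1 + n)) * Ssum B (1 + n - 1) (RtoC x))
    + c (S n) * (RtoC (INR (1 + n)) * Ssum B (1 + n - 1) (- RtoC x))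
    - RtoC (INR (S n)) * c (S n) * RtoC x ^ n)).
  { change (1 + n)%nat with (S n). ring. }
  rewrite !Ssum_shifted. change (1 + n)%nat with (S n).
  rewrite (bernoulli_difference B hB n (RtoC x)).
  replace (- RtoC x + 1) with (1 - RtoC x) by ring. unfold X. ring. }
(* Orders 0 and 1 are split off, because [bernoulli_second_difference] starts at order 2. *)
assert (HX2 : exists l, is_Cseries (fun k => X (S (S k))) l).
{ exists (-1 * (l1 + l2 - l3) - X 1%nat). apply (is_Cseries_shift (fun n => X (S n))).
  replace (-1 * (l1 + l2 - l3) - X 1%nat + X 1%nat) with (-1 * (l1 + l2 - l3)) by ring.
  exact HX1. }
set (a := fun m => (appell_energy (1 - x) (rbern B) (rbern B) m * (2 * PI) ^ (2 * m))%R).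
set (A := fun m => (appell_energy (1 - x) (bern_jump1 B x) (bern_jump2 B x) m
   * (2 * PI) ^ (2 * m))%R).
assert (Hpi := PI_RGT_0).
assert (Hdiv : forall k, Nat.div2 (S k) = Nat.div2 k \/ Nat.div2 (S k) = S (Nat.div2 k)).
{ intros k. destruct (Nat.Even_or_Odd k) as [H|H].
  - left. symmetry. apply Nat.Even_div2, H.
  - right. symmetry. apply Nat.Odd_div2, H. }
set (kappa := ((1 - cos (2 * PI * x)) ^ 2 / (2 * PI) ^ 2)%R).
assert (Hk : (0 < kappa)%R).
{ assert (Hc1 := cos_2PI_lt_1 x Hx). apply Rdiv_lt_0_compat; apply pow_lt; lra. }
assert (HAk : forall m, (kappa <= A m)%R)
  by (intros m; exact (energy_jump_lower_bound B hB x m ltac:(lra))).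
(* Numerator of the quotient: nonincreasing and bounded below by 0. *)
destruct (ex_Cseries_Abel_decreasing _ (fun k => a (Nat.div2 k)) 0 HX2) as [l4 L4].
{ intros k. destruct (Hdiv k) as [->| ->]; [lra|].
  exact (energy_rbern_nonincreasing B hB (1 - x) (Nat.div2 k) ltac:(lra)). }
{ intros k. apply Rmult_le_pos; [|apply pow_le; lra].
  apply appell_energy_nonneg; [lra|]. now apply circle_appell_rbern. }
(* Reciprocal denominator: nondecreasing, and bounded because [A] stays above [kappa]. *)
destruct (ex_Cseries_Abel_increasing _ (fun k => / A (Nat.div2 k))%R (/ kappa)%R
  (ex_intro _ _ L4)) as [l5 L5].
{ intros k. destruct (Hdiv k) as [->| ->]; [lra|].
  apply Rinv_le_contravar; [specialize (HAk (S (Nat.div2 k))); lra|].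
  exact (energy_jump_nonincreasing B hB x (Nat.div2 k) ltac:(lra)). }
{ intros k. apply Rinv_le_contravar; auto. }
exists (l5 + c 1%nat * B 1%nat 1 + c 0%nat * B 0%nat 1).
apply (is_Cseries_shift (fun n => c n * B n 1)).
apply (is_Cseries_shift (fun n => c (S n) * B (S n) 1)).
eapply is_Cseries_ext; [|exact L5]. intros k. cbv beta.
rewrite (bernoulli_second_difference B hB x k Hx) at 1.
unfold X, a, A. ring.
Qed.

Theorem theorem3p1 (B : nat -> C -> C) (hB : is_bernoulli B)
  (r : Rbar) (hr : Rbar_lt 0%R r)
  (c : nat -> C) (f : C -> C) (hf : power_series_on r c f) :
  let cond_a := forall z : C, in_disk r z -> exists l : C, is_sigma' B c z l in
  let cond_b := forall z : C, in_disk r z ->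
    ex_Cseries_from 1 (fun n => c n * B n (z + 1)) in
  let cond_c := forall z : C, in_disk r z ->
    ex_Cseries_from 1 (fun n => RtoC (INR n) * c n * Ssum B (n - 1) z) in
  let cond_d := exists f' : C -> C,
    is_Cderive_on_disk r f f' /\ analytically_summable_on_disk B r f' in
  ((cond_a <-> cond_b) /\ (cond_b <-> cond_c) /\ (cond_c <-> cond_d)) /\
  (cond_a \/ cond_b \/ cond_c \/ cond_d ->
   exists f' f_sigma' f'_sigma : C -> C,
     is_Cderive_on_disk r f f' /\
     (forall z : C, in_disk r z -> is_sigma' B c z (f_sigma' z)) /\
     (forall z : C, in_disk r z -> is_sigma B r f' z (f'_sigma z)) /\
     (forall z : C, in_disk r z ->
        is_Cseries (fun n => c n * B n (z + 1)) (f_sigma' z) /\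
        f_sigma' z = f'_sigma z + f_sigma' 0 /\
        is_Cseries_from 1 (fun n => RtoC (INR n) * c n * Ssum B (n - 1) z)
          (f'_sigma z)) /\
     is_Cseries (fun n => c n * bernoulli_number B n) (f_sigma' 0)).
Proof.
intros cond_a cond_b cond_c cond_d.
assert (D0 : in_disk r 0) by (unfold in_disk; now rewrite Cmod_0).
set (a' := fun n => RtoC (INR (S n)) * c (S n)).
set (g := fun z => CSeries (fun n => a' n * z ^ n)).
assert (Hg : forall z, in_disk r z ->
  is_Cseries (fun n => a' n * z ^ n) (g z) /\ is_Cderive f z (g z)).
{ intros z hz. destruct (is_Cderive_power_series r c f hf z hz) as [l [H1 H2]].
  replace (g z) with l by (symmetry; exact (is_Cseries_unique _ _ H1)). now split. }
assert (Hterm : forall n z, RtoC (INR (1 + n)) * c (1 + n)%nat * Ssum B (1 + n - 1) z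
    = a' n * Ssum B n z).
{ intros n z. replace (1 + n - 1)%nat with n by lia. reflexivity. }
assert (ab : cond_a <-> cond_b).
{ split; intros H z hz; destruct (H z hz) as [l Hl].
  - apply (is_sigma'_iff B hB) in Hl. exists (l - c 0%nat * B 0%nat (z + 1)).
    apply (is_Cseries_shift (fun n => c n * B n (z + 1))).
    replace (l - c 0%nat * B 0%nat (z + 1) + c 0%nat * B 0%nat (z + 1)) with l by ring.
    exact Hl.
  - exists (l + c 0%nat * B 0%nat (z + 1)). apply (is_sigma'_iff B hB).
    now apply (is_Cseries_shift (fun n => c n * B n (z + 1))). }
(* The terms of order 0 cancel since B_0 is constant, so the difference of the full series is the
   sum from 1. *)
assert (bc_sum : forall z l m, is_Cseries (fun n => c n * B n (z + 1)) l ->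
  is_Cseries (fun n => c n * B n 1) m ->
  is_Cseries_from 1 (fun n => RtoC (INR n) * c n * Ssum B (n - 1) z) (l - m)).
{ intros z l m Hl Hm.
  apply is_Cseries_ext with (fun n => c (S n) * B (S n) (z + 1) - c (S n) * B (S n) 1).
  - intros n. transitivity (c (S n) * (RtoC (INR (1 + n)) * Ssum B (1 + n - 1) z)).
    + rewrite Ssum_shifted. change (1 + n)%nat with (S n). ring.
    + change (1 + n)%nat with (S n). ring.
  - apply (is_Cseries_shift (fun n => c n * B n (z + 1) - c n * B n 1)).
    rewrite !(bernoulli_0 B hB).
    replace (l - m + (c 0%nat * 1 - c 0%nat * 1)) with (l - m) by ring.
    now apply is_Cseries_minus. }
assert (b0 : cond_a -> exists m, is_Cseries (fun n => c n * B n 1) m).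
{ intros H. destruct (H 0 D0) as [l Hl]. apply (is_sigma'_iff B hB) in Hl.
  exists l. now rewrite Cplus_0_l in Hl. }
assert (bc : cond_b <-> cond_c).
{ split; intros H z hz.
  - apply ab in H. destruct (b0 H) as [m Hm]. destruct (H z hz) as [l Hl].
    apply (is_sigma'_iff B hB) in Hl. exists (l - m). now apply bc_sum.
  - destruct (bernoulli_numbers_summable B hB r D0 c f hf H) as [m Hm].
    destruct (H z hz) as [l Hl].
    exists (l + (m - c 0%nat * B 0%nat 1)).
    apply is_Cseries_ext with (fun n =>
      RtoC (INR (1 + n)) * c (1 + n)%nat * Ssum B (1 + n - 1) z + c (S n) * B (S n) 1).
    + intros n. transitivity (c (S n) * (RtoC (INR (1 + n)) * Ssum B (1 + n - 1) z)
        + c (S n) * B (S n) 1); [change (1 + n)%nat with (S n); ring|].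
      rewrite Ssum_shifted. change (1 + n)%nat with (S n). ring.
    + apply is_Cseries_plus; [exact Hl|].
      apply (is_Cseries_shift (fun n => c n * B n 1)).
      replace (m - c 0%nat * B 0%nat 1 + c 0%nat * B 0%nat 1) with m by ring. exact Hm. }
assert (sigma_g : forall z l,
  is_Cseries_from 1 (fun n => RtoC (INR n) * c n * Ssum B (n - 1) z) l ->
  is_sigma B r g z l).
{ intros z l Hl. exists a'. split; [intros w hw; apply Hg, hw|].
  apply is_Cseries_ext with (2 := Hl). intros n. apply Hterm. }
assert (cd : cond_c <-> cond_d).
{ split.
  - intros H. exists g. split; [intros z hz; apply Hg, hz|].
    intros z hz. destruct (H z hz) as [l Hl]. exists l. now apply sigma_g.
  (* Both f' and its coefficients are existential here; uniqueness of the derivative and of power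
     series coefficients identifies them with [g] and [a']. *)
  - intros [f' [Hf' Hs]] z hz. destruct (Hs z hz) as [l [a [Ha Hl]]]. exists l.
    assert (Ha' : power_series_on r a' f').
    { intros w hw. destruct (Hg w hw) as [G1 G2].
      rewrite (is_Cderive_unique f w _ _ (Hf' w hw) G2). exact G1. }
    apply is_Cseries_ext with (2 := Hl). intros n.
    rewrite (power_series_coef_unique r a a' f' D0 Ha Ha' n). symmetry. apply Hterm. }
split; [tauto|]. intros Hany.
assert (Ha : cond_a) by tauto.
destruct (b0 Ha) as [m Hm].
set (fs := fun z => CSeries (fun n => c n * B n (z + 1))).
assert (Hfs : forall z, in_disk r z -> is_Cseries (fun n => c n * B n (z + 1)) (fs z)).
{ intros z hz. destruct (Ha z hz) as [l Hl]. apply (is_sigma'_iff B hB) in Hl.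
  now apply CSeries_correct with l. }
assert (Hfs0 : is_Cseries (fun n => c n * B n 1) (fs 0)).
{ assert (H := Hfs 0 D0). now rewrite Cplus_0_l in H. }
(* With f'_sigma taken as fs z - fs 0 the middle identity is immediate; that this is the sum of the
   series is [bc_sum]. *)
exists g, fs, (fun z => fs z - fs 0).
split; [intros z hz; apply Hg, hz|].
split; [intros z hz; now apply (is_sigma'_iff B hB), Hfs|].
split; [intros z hz; apply sigma_g, bc_sum; auto|].
split; [|exact Hfs0].
intros z hz. split; [now apply Hfs|]. split; [ring|]. apply bc_sum; auto.
Qed.
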